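(* Let $n_0\ge 4$ and let $(s_n)_{n\ge n_0}$ be even integers with $2<s_n\le n$ for all $n\ge n_0$ and $s_n/n\to 0$ as $n\to\infty$. Let $f_n:S_n\to\{0,1\}$, $n\ge n_0$, be Boolean functions. Then the sequence $\{f_n\}_{n\ge n_0}$ is noise sensitive (respectively, noise stable) with respect to the interchange process on $K_n$ if and only if it is noise sensitive (respectively, noise stable) with respect to the continuous-time random walk on $S_n$ generated by all $s_n$-cycles.
   Context: $S_n$ is the group of permutations of $[n]=\{1,\dots,n\}$ under composition. The interchange process on the complete graph $K_n$ is the continuous-time Markov chain on $S_n$ with generator $(Qf)(\pi)=\nu\sum_{1\le i<j\le n}\big(f(\pi\,(i,j))-f(\pi)\big)$, where $\nu>0$ is a constant rate. The continuous-time random walk generated by all $s$-cycles is the chain on $S_n$ with generator $(Qf)(\pi)=\nu''\sum_{\sigma\in\mathscr C_s}\big(f(\pi\sigma)-f(\pi)\big)$, where $\mathscr C_s$ is the set of all $s$-cycles in $S_n$ and $\nu''>0$ is a constant rate. Both chains are reversible and (for $s$ even) irreducible with uniform stationary distribution. Relaxation time: for a reversible irreducible continuous-time Markov chain on a finite state space with generator $Q$, $t_{\rm rel}=1/\theta_1$, where $\theta_1$ is the smallest positive eigenvalue of $-Q$. Noise sensitivity/stability: let $X_n(t)$ be reversible irreducible continuous-time Markov chains on finite sets $\Omega_n$ with stationary distributions $\pi_n$ and relaxation times $t^n_{\rm rel}$, started from $X_n(0)\sim\pi_n$. A sequence $f_n:\Omega_n\to\{0,1\}$ is noise sensitive with respect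 to these chains if for all $\alpha>0$, $\lim_{n\to\infty}\mathrm{Cov}\big(f_n(X_n(0)),f_n(X_n(\alpha t^n_{\rm rel}))\big)=0$. It is noise stable if $\lim_{\alpha\to0}\sup_n\mathbb P\big(f_n(X_n(0))\ne f_n(X_n(\alpha t^n_{\rm rel}))\big)=0$. *)

(* Defs.v *)
From HB Require Import structures.
From mathcomp Require Import all_boot all_order all_algebra all_fingroup.
From mathcomp Require Import all_classical all_reals all_analysis.

Set Implicit Arguments.
Unset Strict Implicit.
Unset Printing Implicit Defensive.

Import Order.TTheory GRing.Theory Num.Theory.
Import numFieldNormedType.Exports.

Local Open Scope classical_set_scope.
Local Open Scope ring_scope.

(** * Continuous-time Markov chains on a finite state space

    A generator is given as an operator on real functions of the state. *)

Definition generator (R : realType) (T : finType) : Type :=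
  (T -> R) -> (T -> R).

(* P_t(x, y) is the value at x of exp(t L) applied to the indicator of y. *)
Definition transition (R : realType) (T : finType) (L : generator R T)
    (t : R) (x y : T) : R :=
  limn (series (fun k : nat =>
    t ^+ k / (k`!)%:R * iter k L (fun z => (z == y)%:R) x)).

Definition positive_eigenvalues_opp (R : realType) (T : finType)
    (L : generator R T) : set R :=
  [set theta | 0 < theta /\
     exists2 g : T -> R, g <> (fun=> 0) & forall x, - L g x = theta * g x].

(* The infimum is a minimum: there are finitely many eigenvalues, and at least
   one positive one if L is reversible, irreducible and #|T| > 1. *)
Definition relaxation_time (R : realType) (T : finType)
    (L : generator R T) : R :=
  (inf (positive_eigenvalues_opp L))^-1.

Record process (R : realType) (T : finType) := Process {
  process_display : measure_display;
  process_space : measurableType process_display;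
  process_prob : probability process_space R;
  process_at :> R -> process_space -> T
}.

(* X is a Markov chain (X(t))_{t >= 0} with generator L and initial law mu.
   This prescribes the finite-dimensional distributions only: regularity of the
   sample paths plays no role in the noise notions below. *)
Definition markov_chain (R : realType) (T : finType) (L : generator R T)
    (mu : T -> R) (X : process R T) : Prop :=
  (forall (t : R) (x : T), 0 <= t -> measurable [set w | X t w = x]) /\
  (forall (k : nat) (t : nat -> R) (x : nat -> T),
     t 0%N = 0 -> (forall i, t i <= t i.+1) ->
     process_prob X [set w | forall i, (i <= k)%N -> X (t i) w = x i] =
     (mu (x 0%N) *
       \prod_(i < k) transition L (t i.+1 - t i) (x i) (x i.+1))%:E).

Definition uniform_law (R : realType) (T : finType) : T -> R :=
  fun=> (#|T|%:R)^-1.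

(** * Noise sensitivity and noise stability

    The sequences are indexed by the n >= n0; values at n < n0 are ignored.
    The initial law of X n is not a parameter: it is carried by X n. *)

Definition noise_sensitive (R : realType) (n0 : nat) (T : nat -> finType)
    (L : forall n, generator R (T n)) (X : forall n, process R (T n))
    (f : forall n, T n -> bool) : Prop :=
  forall alpha : R, 0 < alpha ->
    (fun n => if (n0 <= n)%N then
       covariance (process_prob (X n))
         (fun w => (f n (X n 0 w))%:R)
         (fun w => (f n (X n (alpha * relaxation_time (L n)) w))%:R)
     else 0%E) @ \oo --> 0%E.

Definition noise_stable (R : realType) (n0 : nat) (T : nat -> finType)
    (L : forall n, generator R (T n)) (X : forall n, process R (T n))
    (f : forall n, T n -> bool) : Prop :=
  ereal_sup [set process_prob (X n)
      [set w | f n (X n 0 w) != f n (X n (alpha * relaxation_time (L n)) w)]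
    | n in [set n | (n0 <= n)%N]] @[alpha --> (0 : R)^'+] --> 0%E.

(** * Random walks on the symmetric group

    In MathComp [(s * p)%g] applies s first, so the composition "p after s",
    written p s in the usual convention for functions, is [(s * p)%g]. *)

Definition interchange_generator (R : realType) (nu : R) (n : nat) :
    generator R 'S_n :=
  fun f p => nu * \sum_(i < n) \sum_(j < n | (i < j)%N)
                    (f (tperm i j * p)%g - f p).

(* For s >= 2: one cycle of length s, all the points outside it being fixed. *)
Definition is_cycle (n s : nat) (c : 'S_n) : bool :=
  [exists x : 'I_n, (#|porbit c x| == s) && perm_on (porbit c x) c].

Definition cycle_generator (R : realType) (nu : R) (n s : nat) :
    generator R 'S_n :=
  fun f p => nu * \sum_(c : 'S_n | is_cycle s c) (f (c * p)%g - f p).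

(* Main.v *)
Require Import Defs.
From HB Require Import structures.
From mathcomp Require Import all_boot all_order all_algebra all_fingroup.
From mathcomp Require Import all_classical all_reals all_analysis.
From mathcomp Require Import complex ring lra zify.

Set Implicit Arguments.
Unset Strict Implicit.
Unset Printing Implicit Defensive.

Import Order.TTheory GRing.Theory Num.Theory.
Import numFieldNormedType.Exports.

Local Open Scope ring_scope.

(** The interchange process is the walk generated by 2-cycles, so both chains
    belong to one family: walks on ['S_n] generated by all [s]-cycles with [s]
    even. Their generators are given by averages over conjugacy classes; hence
    they are self-adjoint, commute, and split the space of functions into joint
    eigenvectors. For a joint eigenvector let its rate for a walk be its
    eigenvalue divided by the smallest positive one. The covariance of [f] with
    itself after [alpha] relaxation times is the sum of [exp (- alpha * rate)]
    against the spectral masses of [f], and the probability that [f] changes is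
    twice the sum of [1 - exp (- alpha * rate)]. Therefore sensitivity says that
    the mass at bounded rates vanishes in the limit and stability that the mass
    at large rates is uniformly small. It remains to show that a bounded rate for
    one walk implies a bounded rate for the other, uniformly in [n].

    The comparison goes through the degree: the least [k] such that the
    eigenvector is not orthogonal to the functions of [k] of the values [p x].
    Low degree implies low rate ([eigen_low_degree]): the average over the
    permutations of all but [k] points is then a nonzero eigenvector with the
    same eigenvalue, and a random [s]-cycle avoids these [k] points with
    probability at least [1 - k s / n]. High degree implies high rate
    ([eigen_high_degree]), which is proved in three steps, with no appeal to the
    characters of ['S_n].

    First, an [s]-cycle may be compared with a uniform shuffle of its support.
    The average over the cyclic permutations of a set [A] is the identity on the
    functions invariant under the permutations of [A], is [-1] on the sign
    component as [#|A|] is even, and has norm at most [1/2] on the rest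
    ([cycavg_contract]); thus the walk loses between one half and twice what is
    lost on average under the shuffle of a random set of [s] points.

    Second, the mean loss under the shuffle of a random set of [m] points,
    divided by [m - 1], does not increase with [m] ([symmass_mono]). Taking
    [m = n] bounds the spectral gap from below by a multiple of [s / n]; taking
    [m] a small multiple of [n], which exceeds [s] because [s / n] tends to 0,
    reduces the question to such [m].

    Third, the shuffle of a random set of a given proportion of the points loses
    at least half of every function of sufficiently high degree
    ([symmass_half]). This follows from [degree_ge_sum_symavgU1]: among the
    values on which a function of high degree depends, many matter. *)

(** * Inner product and joint eigenvectors *)

Section InnerProduct.
Variables (R : realFieldType) (T : finType).
Implicit Types (f g h : {ffun T -> R^o}) (a : R).

Definition dot f g : R := \sum_x f x * g x.

Lemma dotC f g : dot f g = dot g f.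
Proof. by apply: eq_bigr => x _; rewrite mulrC. Qed.

Lemma dotDl f g h : dot (f + g) h = dot f h + dot g h.
Proof. by rewrite -big_split; apply: eq_bigr => x _; rewrite ffunE mulrDl. Qed.

Lemma dotZl a f g : dot (a *: f) g = a * dot f g.
Proof. by rewrite mulr_sumr; apply: eq_bigr => x _; rewrite ffunE -mulrA. Qed.

Lemma dotDr f g h : dot f (g + h) = dot f g + dot f h.
Proof. by rewrite dotC dotDl !(dotC f). Qed.

Lemma dotZr a f g : dot f (a *: g) = a * dot f g.
Proof. by rewrite dotC dotZl (dotC f). Qed.

Lemma dotNl f g : dot (- f) g = - dot f g.
Proof. by rewrite -scaleN1r dotZl mulN1r. Qed.

Lemma dotNr f g : dot f (- g) = - dot f g.
Proof. by rewrite dotC dotNl dotC. Qed.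

Lemma dotBl f g h : dot (f - g) h = dot f h - dot g h.
Proof. by rewrite dotDl dotNl. Qed.

Lemma dotBr f g h : dot f (g - h) = dot f g - dot f h.
Proof. by rewrite dotDr dotNr. Qed.

Lemma dot0l f : dot 0 f = 0.
Proof. by rewrite -(scale0r (0 : {ffun T -> R^o})) dotZl mul0r. Qed.

Lemma dot0r f : dot f 0 = 0.
Proof. by rewrite dotC dot0l. Qed.

Lemma dot_suml I (r : seq I) (P : pred I) (F : I -> {ffun T -> R^o}) g :
  dot (\sum_(i <- r | P i) F i) g = \sum_(i <- r | P i) dot (F i) g.
Proof. by apply: (big_morph (dot^~ g)) => [f h|]; rewrite ?dotDl ?dot0l. Qed.

Lemma dot_sumr I (r : seq I) (P : pred I) (F : I -> {ffun T -> R^o}) g :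
  dot g (\sum_(i <- r | P i) F i) = \sum_(i <- r | P i) dot g (F i).
Proof. by rewrite dotC dot_suml; apply: eq_bigr => i _; rewrite dotC. Qed.

Lemma dot_ge0 f : 0 <= dot f f.
Proof. by apply: sumr_ge0 => x _; rewrite -expr2 sqr_ge0. Qed.

Lemma dot_eq0 f : (dot f f == 0) = (f == 0).
Proof.
apply/idP/eqP => [|->]; last by rewrite dot0l.
rewrite psumr_eq0 => [/allP f0|x _]; last by rewrite -expr2 sqr_ge0.
apply/ffunP => x; have := f0 x (mem_index_enum x).
by rewrite ffunE /= mulf_eq0 orbb => /eqP.
Qed.

Lemma dot_gt0 f : f != 0 -> 0 < dot f f.
Proof. by move=> f0; rewrite lt_def dot_eq0 f0 dot_ge0. Qed.

Lemma dot_ext f g : (forall h, dot f h = dot g h) -> f = g.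
Proof.
move=> fg; apply/eqP; rewrite -subr_eq0 -dot_eq0 dotBl.
by rewrite fg subrr.
Qed.

Lemma sqr_dot_le f g : dot f g ^+ 2 <= dot f f * dot g g.
Proof.
have [->|f0] := eqVneq f 0; first by rewrite !dot0l mul0r expr0n.
have := dot_ge0 (dot f f *: g - dot f g *: f).
rewrite dotBl !dotBr !dotZl !dotZr (dotC g f) => D.
have {}D : 0 <= dot f f * (dot f f * dot g g - dot f g ^+ 2).
  by apply: le_trans D _; rewrite le_eqVlt; apply/orP; left; apply/eqP; ring.
by rewrite -subr_ge0 -(pmulr_rge0 _ (dot_gt0 f0)).
Qed.

Lemma dot_le_half f g : dot f g <= (dot f f + dot g g) / 2.
Proof.
have := dot_ge0 (f - g); rewrite dotBl !dotBr (dotC g f).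
by rewrite ler_pdivlMr ?ltr0n // => D; lra.
Qed.

Lemma dot_mean_le (I : finType) (A : {set I}) (u : I -> {ffun T -> R^o}) (c : R) :
  (forall i, i \in A -> dot (u i) (u i) <= c) -> 0 <= c ->
  dot (#|A|%:R^-1 *: \sum_(i in A) u i) (#|A|%:R^-1 *: \sum_(i in A) u i) <= c.
Proof.
move=> uc c0; set v := _ *: _.
have [A0|A0] := eqVneq A finset.set0.
  by rewrite /v A0 big_set0 scaler0 dot0l.
have a0 : 0 < #|A|%:R :> R by rewrite ltr0n card_gt0.
have vv : dot v v = #|A|%:R^-1 * \sum_(i in A) dot (u i) v.
  by rewrite -dot_suml -dotZl.
have : dot v v <= #|A|%:R^-1 * \sum_(i in A) (c + dot v v) / 2.
  rewrite {1}vv ler_pM2l ?invr_gt0 //; apply: ler_sum => i iA.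
  apply: le_trans (dot_le_half _ _) _; rewrite ler_wpM2r ?invr_ge0 //.
  by rewrite lerD2r uc.
by rewrite sumr_const -[X in _ * X]mulr_natl mulKf ?gt_eqF //; lra.
Qed.

(** A self-adjoint idempotent is an orthogonal projection. *)
Lemma dot_proj (P : {linear {ffun T -> R^o} -> {ffun T -> R^o}}) f :
  (forall g h, dot (P g) h = dot g (P h)) -> (forall g, P (P g) = P g) ->
  dot (f - P f) (f - P f) = dot f f - dot (P f) (P f).
Proof.
move=> Psym PP; have PPf : dot (P f) (P f) = dot f (P f) by rewrite Psym PP.
by rewrite dotBl !dotBr (dotC (P f) f) PPf; ring.
Qed.

End InnerProduct.

Section Spectral.
Variable R : rcfType.

(** Over [R[i]] the matrix is Hermitian, hence diagonalizable with real
    eigenvalues; so its minimal polynomial, which has coefficients in [R], splits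
    over [R] with simple roots. *)
Lemma symmetric_diagonalizable n (A : 'M[R]_n) :
  A^T = A -> diagonalizable_in unitmx A.
Proof.
case: n A => [|n] A Asym.
  by rewrite [A]thinmx0; exact: diagonalizable0.
pose C := R[i]; pose u := real_complex R.
pose B : 'M[C]_n.+1 := map_mx u A.
have Bherm : B \is hermsymmx.
  apply: realsym_hermsym.
    apply/is_hermitianmxP; rewrite expr0 scale1r /B.
    by apply/matrixP => i j; rewrite !mxE -[in LHS]Asym mxE.
  by apply/mxOverP => i j; rewrite mxE; apply/complex_realP; exists (A i j).
have Breal := hermitian_spectral_diag_real Bherm.
have /hermitian_normalmx /orthomx_spectralP Beq := Bherm.
set P := spectralmx B in Beq; set d := spectral_diag B in Beq Breal.
have Punit : P \in unitmx := spectral_unit B.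
clearbody P d.
have [D dD] : exists D : 'rV[R]_n.+1, d = map_mx u D.
  exists (\row_j complex.Re (d 0 j)); apply/rowP => j; rewrite !mxE.
  by have /mxOverP /(_ 0 j) /complex_realP [x ->] := Breal.
pose rs := undup [seq D 0 i | i <- enum 'I_n.+1].
apply/diagonalizableP; exists rs; first exact: undup_uniq.
rewrite -(dvdp_map u) -mxminpoly_map -/B.
have -> : map_poly u (\prod_(x <- rs) ('X - x%:P)) =
  \prod_(x <- map u rs) ('X - x%:P).
  rewrite rmorph_prod big_map; apply: eq_bigr => x _.
  by rewrite /= rmorphB /= map_polyX map_polyC.
have -> : map u rs = undup [seq d 0 i | i <- enum 'I_n.+1].
  rewrite -undup_map_inj; last exact: fmorph_inj.
  by rewrite -map_comp dD; congr undup; apply: eq_map => i; rewrite /= mxE.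
have -> : B = conjmx (invmx P) (diag_mx d) by rewrite conjVmx.
by rewrite mxminpoly_uconj ?unitmx_inv // mxminpoly_diag.
Qed.

(** Indexing the summands by their pair of eigenvalues makes them pairwise
    orthogonal, since eigenvectors of a self-adjoint operator for distinct
    eigenvalues are. *)
Lemma joint_spectral (T : finType)
    (P Q : {linear {ffun T -> R^o} -> {ffun T -> R^o}}) :
  (forall f g, dot (P f) g = dot f (P g)) ->
  (forall f g, dot (Q f) g = dot f (Q g)) ->
  (forall f, P (Q f) = Q (P f)) ->
  forall f, exists (s : seq (R * R)) (phi : R * R -> {ffun T -> R^o}),
    [/\ uniq s, f = \sum_(p <- s) phi p &
        forall p, P (phi p) = p.1 *: phi p /\ Q (phi p) = p.2 *: phi p].
Proof.
move=> Psym Qsym PQ f.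
pose n := #|T|.
pose vec (g : {ffun T -> R^o}) : 'rV[R]_n := \row_i g (enum_val i).
pose fct (v : 'rV[R]_n) : {ffun T -> R^o} := [ffun x => v 0 (enum_rank x)].
have vecK : cancel vec fct.
  by move=> g; apply/ffunP => x; rewrite ffunE mxE enum_rankK.
have fctD v w : fct (v + w) = fct v + fct w.
  by apply/ffunP => x; rewrite !ffunE mxE.
have fctZ a v : fct (a *: v) = a *: fct v.
  by apply/ffunP => x; rewrite !ffunE mxE.
have fct0 : fct 0 = 0 by apply/ffunP => x; rewrite !ffunE mxE.
pose mat (L : {ffun T -> R^o} -> {ffun T -> R^o}) : 'M[R]_n :=
  \matrix_(i, j) dot (fct (delta_mx 0 i)) (L (fct (delta_mx 0 j))).
have dotd i g : dot (fct (delta_mx 0 i)) g = g (enum_val i).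
  rewrite /dot (bigD1 (enum_val i)) //= ffunE mxE !eqxx enum_valK eqxx mul1r.
  rewrite big1 ?addr0 // => x; rewrite ffunE mxE eqxx /= => xi.
  case: eqP => [E|]; last by rewrite mul0r.
  by rewrite -E enum_rankK eqxx in xi.
have matsym (L : {ffun T -> R^o} -> {ffun T -> R^o}) :
    (forall f g, dot (L f) g = dot f (L g)) -> (mat L)^T = mat L.
  by move=> Lsym; apply/matrixP => i j; rewrite !mxE -Lsym dotC.
have matE (L : {linear {ffun T -> R^o} -> {ffun T -> R^o}}) v :
    (forall f g, dot (L f) g = dot f (L g)) -> L (fct v) = fct (v *m mat L).
  move=> Lsym; apply/ffunP => x; rewrite [RHS]ffunE mxE.
  rewrite -[x in LHS]enum_rankK -dotd -Lsym.
  rewrite {1}[v]row_sum_delta.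
  rewrite (big_morph fct fctD fct0) dot_sumr; apply: eq_bigr => i _.
  by rewrite fctZ dotZr mxE Lsym -[in RHS]Lsym [in RHS]dotC.
have matM : comm_mx (mat P) (mat Q).
  have E (v : 'rV[R]_n) : v *m (mat P *m mat Q) = v *m (mat Q *m mat P).
    have fct_inj : injective fct.
      move=> a b ab; apply/rowP => i; have /ffunP /(_ (enum_val i)) := ab.
      by rewrite !ffunE enum_valK.
    by apply: fct_inj; rewrite !mulmxA -!matE.
  by apply/row_matrixP => i; rewrite !rowE E.
have cod : codiagonalizable [:: mat P; mat Q].
  apply/codiagonalizableP; split=> [A B|A]; rewrite !inE.
    by move=> /orP[] /eqP -> /orP[] /eqP -> //; rewrite /comm_mx -matM.
  by move=> /orP[] /eqP ->; apply/symmetric_diagonalizable/matsym.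
case: cod => M Munit /=; rewrite andbT => /andP[].
move=> /diagonalizable_forPex[a /(simmxPp (stablemx_unit _ Munit)) Pa].
move=> /diagonalizable_forPex[b /(simmxPp (stablemx_unit _ Munit)) Qb].
pose c := vec f *m invmx M.
pose pr (i : 'I_n) := (a 0 i, b 0 i).
pose phi (p : R * R) : {ffun T -> R^o} :=
  \sum_(i | pr i == p) fct (c 0 i *: row i M).
exists (undup [seq pr i | i <- enum 'I_n]), phi; split; first exact: undup_uniq.
  rewrite -[LHS]vecK -[vec f](mulmxKV Munit) -/c mulmx_sum_row.
  rewrite (big_morph fct fctD fct0) (exchange_big_dep xpredT) //=;
    apply: eq_bigr => i _.
  under eq_bigl do rewrite eq_sym.
  rewrite -big_filter filter_pred1_uniq ?undup_uniq ?big_seq1 //.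
  by rewrite mem_undup map_f ?mem_enum.
have row_eigen (d : 'rV[R]_n) (A : 'M[R]_n) i :
    M *m A = diag_mx d *m M -> row i M *m A = d 0 i *: row i M.
  by move=> MA; rewrite -row_mul MA row_mul row_diag_mx -scalemxAl -rowE.
move=> p; rewrite !scaler_sumr !raddf_sum /=.
split; apply: eq_bigr => i /eqP <-.
  by rewrite matE // -scalemxAl (row_eigen a) // scalerA mulrC -scalerA fctZ.
by rewrite matE // -scalemxAl (row_eigen b) // scalerA mulrC -scalerA fctZ.
Qed.

End Spectral.

(** * Averaging operators on functions of a permutation *)

Section Action.
Variables (R : realFieldType) (n : nat).
Local Notation V := {ffun 'S_n -> R^o}.
Implicit Types (f g h : V) (s t : 'S_n) (G : {set 'S_n}).

(** A right action: [act (s * t)] is [act t] after [act s]. *)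
Definition act s f : V := [ffun p => f (s * p)%g].

Fact act_linear s : linear (act s).
Proof. by move=> a f g; apply/ffunP => p; rewrite !ffunE. Qed.

HB.instance Definition _ s :=
  GRing.isLinear.Build R V V *:%R (act s) (act_linear s).

Lemma act1 f : act 1 f = f.
Proof. by apply/ffunP => p; rewrite ffunE mul1g. Qed.

Lemma actM s t f : act (s * t) f = act t (act s f).
Proof. by apply/ffunP => p; rewrite !ffunE mulgA. Qed.

Lemma dot_act s f g : dot (act s f) g = dot f (act s^-1 g).
Proof.
rewrite /dot (reindex_inj (mulgI s^-1%g)) /=.
by apply: eq_bigr => p _; rewrite !ffunE mulKVg.
Qed.

Lemma dot_act_act s f : dot (act s f) (act s f) = dot f f.
Proof. by rewrite dot_act -actM mulgV act1. Qed.

Lemma scalerMnV f m : (0 < m)%N -> m%:R^-1 *: (f *+ m) = f.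
Proof.
move=> m0; rewrite -[f *+ m]scaler_nat scalerA mulVf ?scale1r //.
by rewrite pnatr_eq0 -lt0n.
Qed.

(** The lock keeps unification from reading [avg G f] as a scaled sum when
    rewriting with the linearity lemmas. *)
Fact avg_key : unit. Proof. by []. Qed.

Definition avg : {set 'S_n} -> V -> V := locked_with avg_key
  (fun G f => #|G|%:R^-1 *: \sum_(s in G) act s f).

Lemma avgE G f : avg G f = #|G|%:R^-1 *: \sum_(s in G) act s f.
Proof. by rewrite /avg unlock. Qed.

Fact avg_linear G : linear (avg G).
Proof.
move=> a f g; rewrite !avgE; under eq_bigr do rewrite linearP.
by rewrite big_split /= -scaler_sumr scalerDr !scalerA mulrC.
Qed.

HB.instance Definition _ G :=
  GRing.isLinear.Build R V V *:%R (avg G) (avg_linear G).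

Lemma avg_sym G : (forall s, (s^-1%g \in G) = (s \in G)) ->
  forall f g, dot (avg G f) g = dot f (avg G g).
Proof.
move=> GV f g; rewrite !avgE dotZl dotZr dot_suml dot_sumr; congr (_ * _).
rewrite (reindex_inj invg_inj) /=; apply: eq_big => [s|s _]; first exact: GV.
by rewrite dot_act invgK.
Qed.

(** Averaging over a conjugation invariant set is a central operator. *)
Lemma act_avg G : (forall s t, ((s ^ t)%g \in G) = (s \in G)) ->
  forall t f, act t (avg G f) = avg G (act t f).
Proof.
move=> GJ t f; rewrite !avgE linearZ_LR linear_sum /=; congr (_ *: _).
rewrite [RHS](reindex_inj (conjg_inj t)) /=.
apply: eq_big => [s|s _]; first by rewrite GJ.
by rewrite -!actM conjgE mulKVg.
Qed.

Lemma avg_fixed G f : (0 < #|G|)%N -> (forall s, s \in G -> act s f = f) ->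
  avg G f = f.
Proof.
by move=> G0 Gf; rewrite avgE (eq_bigr (fun=> f)) // sumr_const scalerMnV.
Qed.

Lemma act_avg_group (G : {group 'S_n}) s f : s \in G -> act s (avg G f) = avg G f.
Proof.
move=> Gs; rewrite avgE linearZ_LR linear_sum /=; congr (_ *: _).
rewrite [RHS](reindex_inj (mulIg s)) /=.
by apply: eq_big => [t|t _]; rewrite ?groupMr // -actM.
Qed.

Lemma avg_act_group (G : {group 'S_n}) s f : s \in G -> avg G (act s f) = avg G f.
Proof.
move=> Gs; rewrite !avgE; congr (_ *: _).
rewrite [RHS](reindex_inj (mulgI s)) /=.
by apply: eq_big => [t|t _]; rewrite ?groupMl // -actM.
Qed.

Lemma avg_group_fixed (G : {group 'S_n}) f s :
  avg G f = f -> s \in G -> act s f = f.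
Proof. by move=> <- /act_avg_group. Qed.

Lemma avg_sub_group (G : {group 'S_n}) (S : {set 'S_n}) f : (0 < #|S|)%N ->
  S \subset G -> avg S (avg G f) = avg G f.
Proof.
by move=> S0 /fintype.subsetP SG; apply: avg_fixed => // s /SG /act_avg_group.
Qed.

Lemma avg_group_sub (G : {group 'S_n}) (S : {set 'S_n}) f : (0 < #|S|)%N ->
  S \subset G -> avg G (avg S f) = avg G f.
Proof.
move=> S0 /fintype.subsetP SG; rewrite [avg S f]avgE linearZ_LR linear_sum /=.
rewrite (eq_bigr (fun=> avg G f)) => [|s /SG Gs]; last exact: avg_act_group.
by rewrite sumr_const scalerMnV.
Qed.

Lemma avg_comm (G S : {set 'S_n}) f :
  (forall s t, ((s ^ t)%g \in G) = (s \in G)) ->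
  avg G (avg S f) = avg S (avg G f).
Proof.
move=> GJ; rewrite ![avg S _]avgE linearZ_LR linear_sum /=; congr (_ *: _).
by apply: eq_bigr => s _; rewrite (act_avg GJ).
Qed.

Lemma dot_avg_le G f : dot (avg G f) (avg G f) <= dot f f.
Proof.
rewrite avgE; apply: dot_mean_le => [s _|]; last exact: dot_ge0.
by rewrite dot_act_act.
Qed.

End Action.

(** * Averages over the permutations of a subset *)

Section SymAverage.
Variables (R : realFieldType) (n : nat).
Local Notation V := {ffun 'S_n -> R^o}.
Implicit Types (f g h u v : V) (s t : 'S_n) (A B C : {set 'I_n}) (i j : 'I_n).

(** The orthogonal projection onto the functions that depend on the values
    [p x], [x] outside [A], only. *)
Definition symavg A : V -> V := avg (Sym A).
HB.instance Definition _ A := GRing.Linear.on (symavg A).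
Local Notation E := symavg.

Lemma mem_Sym A s : (s \in Sym A) = perm_on A s.
Proof. by rewrite inE. Qed.

Lemma tperm_Sym A i j : i \in A -> j \in A -> tperm i j \in Sym A.
Proof.
move=> iA jA; rewrite mem_Sym; apply: fintype.subset_trans (tperm_on i j) _.
by apply/fintype.subsetP => x; rewrite !inE => /orP[] /eqP ->.
Qed.

Lemma Sym_sub A B : A \subset B -> Sym A \subset Sym B.
Proof.
by move=> AB; apply/fintype.subsetP => s;
  rewrite !mem_Sym => /fintype.subset_trans; apply.
Qed.

Lemma Sym_card_gt0 A : (0 < #|Sym A|)%N.
Proof. by rewrite card_Sym fact_gt0. Qed.

Lemma symavg_sym A f g : dot (E A f) g = dot f (E A g).
Proof. by apply: avg_sym => s; rewrite groupV. Qed.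

Lemma symavg_sub A B f : A \subset B -> E A (E B f) = E B f.
Proof. by move=> AB; rewrite /symavg avg_sub_group ?Sym_card_gt0 ?Sym_sub. Qed.

Lemma symavg_sup A B f : A \subset B -> E B (E A f) = E B f.
Proof. by move=> AB; rewrite /symavg avg_group_sub ?Sym_card_gt0 ?Sym_sub. Qed.

Lemma symavg_id A f : E A (E A f) = E A f.
Proof. exact: symavg_sub. Qed.

Lemma dot_symavg A f : dot (E A f) (E A f) = dot (E A f) f.
Proof. by rewrite symavg_sym symavg_id dotC. Qed.

Lemma dot_symavg_le A f : dot (E A f) (E A f) <= dot f f.
Proof. exact: dot_avg_le. Qed.

Lemma dot_symavgB A f :
  dot (f - E A f) (f - E A f) = dot f f - dot (E A f) (E A f).
Proof. by apply: dot_proj => [g h|g]; [exact: symavg_sym | exact: symavg_id]. Qed.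

Lemma dot_symavgB_sub A B f : A \subset B ->
  dot (E A f - E B f) (E A f - E B f) =
  dot (E A f) (E A f) - dot (E B f) (E B f).
Proof. by move=> AB; rewrite -(symavg_sup f AB) dot_symavgB. Qed.

Lemma symavg_fixed A f s : E A f = f -> s \in Sym A -> act s f = f.
Proof. exact: avg_group_fixed. Qed.

Lemma act_symavg s A f : act s (E A f) = E (s @: A) (act s f).
Proof.
rewrite /symavg !avgE linearZ_LR linear_sum /= !card_Sym card_imset;
  last exact: perm_inj.
congr (_ *: _); rewrite [RHS](reindex_inj (conjg_inj s)) /=.
apply: eq_big => [t|t _]; last by rewrite -!actM conjgE mulKVg.
rewrite !mem_Sym; apply/fintype.subsetP/fintype.subsetP => H x; rewrite !inE.
  rewrite -[x](permKV s) permJ (inj_eq perm_inj) mem_imset; last exact: perm_inj.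
  by move=> tx; apply: H; rewrite inE.
move=> tx; rewrite -(mem_imset _ _ (@perm_inj _ s)); apply: H.
by rewrite inE permJ (inj_eq perm_inj).
Qed.

Lemma symavg_small A f : (#|A| <= 1)%N -> E A f = f.
Proof.
move=> A1; apply: avg_fixed => [|s]; first exact: Sym_card_gt0.
by rewrite mem_Sym => /perm_on_id -> //; rewrite act1.
Qed.

(** Coset decomposition of the permutations of [i |: A] along the preimage of
    [i]. *)
Lemma symavgU1 A i f : i \notin A ->
  E (i |: A) f =
  (#|A|.+1%:R)^-1 *: \sum_(a in i |: A) act (tperm i a) (E A f).
Proof.
move=> iA; rewrite /symavg !avgE !card_Sym cardsU1 iA add1n factS.
under [in RHS]eq_bigr do rewrite linearZ_LR linear_sum /=.
rewrite -scaler_sumr scalerA -invfM -natrM; congr (_ *: _).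
rewrite (partition_big (fun s : 'S_n => s i) (mem (i |: A))) /=; last first.
  by move=> s; rewrite mem_Sym => /perm_closed ->; rewrite setU11.
apply: eq_bigr => a aiA.
rewrite (reindex_inj (mulIg (tperm i a))) /=.
apply: eq_big => [s|s _]; last by rewrite actM.
rewrite permM; apply/andP/idP => [[sS /eqP sa]|].
  have si : s i = i.
    by apply: (@perm_inj _ (tperm i a)); rewrite sa tpermL.
  rewrite mem_Sym; apply/fintype.subsetP => x; rewrite inE => sx.
  have : x \in i |: A.
    move: sS; rewrite groupMr ?tperm_Sym ?setU11 // mem_Sym => /fintype.subsetP;
      apply.
    by rewrite inE.
  by rewrite !inE => /orP[/eqP xi|//]; rewrite xi si eqxx in sx.
rewrite mem_Sym => sA; rewrite (out_perm sA iA) tpermL; split=> //.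
rewrite groupMr ?tperm_Sym ?setU11 //.
by rewrite (fintype.subsetP (Sym_sub (finset.subsetUr _ _))) ?mem_Sym.
Qed.

(** The transpositions joining [j] to the points of [B] are conjugate under the
    permutations of [B], so they have the same compression to the functions
    fixed by these, and [symavgU1] gives their sum. *)
Lemma symavg_tperm B i j f : i \in B -> j \notin B -> E B f = f ->
  E B (act (tperm i j) f) =
  #|B|%:R^-1 *: (#|B|.+1%:R *: E (j |: B) f - f).
Proof.
move=> iB jB Bf; have B0 : (#|B|%:R : R) != 0.
  by rewrite pnatr_eq0 -lt0n; apply/card_gt0P; exists i.
have := congr1 (fun g => #|B|.+1%:R *: E B g) (symavgU1 f jB).
rewrite /= linearZ_LR scalerA mulfV ?pnatr_eq0 // scale1r.
rewrite symavg_sub ?finset.subsetUr // linear_sum /= big_setU1 //= tperm1 act1 Bf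
  Bf.
rewrite (eq_bigr (fun=> E B (act (tperm i j) f))) => [->|a aB].
  by rewrite [_ - f]addrC addKr sumr_const scalerMnV // -(ltr0n R) lt0r B0 ler0n.
have -> : tperm j a = (tperm i j ^ tperm i a)%g.
  rewrite tpermJ tpermL tpermD 1?tpermC //; first by apply: contraNneq jB => <-.
  by apply: contraNneq jB => <-.
have ia := tperm_Sym iB aB.
rewrite conjgE !actM (symavg_fixed Bf) ?groupV //.
by rewrite /symavg avg_act_group.
Qed.

End SymAverage.

Section SymAverageInequalities.
Variables (R : realFieldType) (n : nat).
Local Notation V := {ffun 'S_n -> R^o}.
Local Notation E := symavg.
Implicit Types (f g h u v : V) (s t : 'S_n) (A B C : {set 'I_n}) (i j : 'I_n).

Lemma imset_tpermU1 i j A : i \notin A -> j \notin A ->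
  tperm i j @: (i |: A) = j |: A.
Proof.
move=> iA jA; apply/setP => x.
rewrite -[x in LHS](tpermK i j) mem_imset; last exact: perm_inj.
rewrite !inE.
case: tpermP => [->|->|/eqP xi /eqP xj].
- by rewrite (negPf iA) (negPf jA) !orbF eq_sym.
- by rewrite !eqxx.
- by rewrite (negPf xi) (negPf xj).
Qed.

Lemma dot_symavg_sup A B u : A \subset B ->
  dot (E A u) (E B u) = dot (E B u) (E B u).
Proof. by move=> AB; rewrite symavg_sym symavg_sub // dotC dot_symavg. Qed.

(** Once their common part is removed, the ranges of the averages over
    [i |: A] and [j |: A] meet at an angle of cosine [-1 / (#|A| + 1)]: the
    transposition of [i] and [j] exchanges them, and [symavg_tperm] is its
    compression. *)
Lemma dot_symavg_exchange A i j u : i != j -> i \notin A -> j \notin A ->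
  let C := j |: (i |: A) in
  2 * (dot (E (i |: A) u) (E (j |: A) u) - dot (E C u) (E C u)) <=
  (#|A|.+1%:R)^-1 * (dot (E (i |: A) u) (E (i |: A) u)
    + dot (E (j |: A) u) (E (j |: A) u) - 2 * dot (E C u) (E C u)).
Proof.
move=> ij iA jA; cbv zeta; set C := j |: (i |: A); set B := i |: A;
  set B' := j |: A.
have BC : B \subset C by rewrite finset.subsetUr.
have B'C : B' \subset C by rewrite finset.setUS // finset.subsetUr.
have jB : j \notin B by rewrite !inE eq_sym negb_or ij.
have iB : i \in B by rewrite setU11.
have cB : #|B| = #|A|.+1 by rewrite cardsU1 iA.
pose a := E B u - E C u; pose b := E B' u - E C u; pose b' := act (tperm i j) b.
have ijC : tperm i j \in Sym C by rewrite tperm_Sym ?inE ?eqxx ?orbT.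
have Eb' : E B b' = b'.
  rewrite /b' [act _ _]raddfB /= act_symavg tpermC imset_tpermU1 // -tpermC.
  rewrite {2}/symavg act_avg_group // -/(E C u).
  by rewrite raddfB /= symavg_id symavg_sub.
have ECb' : E C b' = 0.
  rewrite /b' {1}/symavg avg_act_group // -/(E C b) /b raddfB /=.
  by rewrite symavg_id symavg_sup // subrr.
have ab : dot a b = - (#|A|.+1%:R)^-1 * dot a b'.
  have -> : b = act (tperm i j) b' by rewrite /b' -actM tperm2 act1.
  have -> : a = E B a by rewrite /a raddfB /= symavg_id symavg_sub.
  rewrite symavg_sym symavg_tperm // ECb' scaler0 sub0r dotZr dotNr cB.
  by rewrite symavg_sym Eb'; ring.
have <- : dot a b = dot (E B u) (E B' u) - dot (E C u) (E C u).
  rewrite /a /b dotBl !dotBr (dot_symavg_sup _ BC).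
  by rewrite (dotC (E C u) (E B' u)) (dot_symavg_sup _ B'C); ring.
have -> : dot (E B u) (E B u) + dot (E B' u) (E B' u) - 2 * dot (E C u) (E C u)
    = dot a a + dot b' b'.
  by rewrite /b' dot_act_act /a /b !dot_symavgB_sub //; ring.
have := dot_le_half (- a) b'; rewrite dotNl dotNl dotNr opprK => D.
have c0 : 0 < (#|A|.+1%:R)^-1 :> R by rewrite invr_gt0 ltr0n.
rewrite ab -subr_ge0.
have -> : #|A|.+1%:R^-1 * (dot a a + dot b' b') - 2 * (- #|A|.+1%:R^-1 * dot a b')
  = #|A|.+1%:R^-1 * (dot a a + dot b' b' + 2 * dot a b') by ring.
by apply: mulr_ge0; [exact: ltW | lra].
Qed.

(** By [symavg_tperm] the sum [s] of the averages over the one-point deletions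
    of [A] satisfies [dot s s = m / (m - 1) * S], [m] the size of [A] and [S] the
    left-hand side, while [dot s g = S]; conclude by Cauchy-Schwarz. *)
Lemma sum_symavgD1_le A g : (1 < #|A|)%N -> E A g = 0 ->
  \sum_(i in A) dot (E (A :\ i) g) (E (A :\ i) g) <=
  #|A|%:R / (#|A|.-1)%:R * dot g g.
Proof.
move=> A1 Ag; set S := \sum_(i in A) _.
have m0 : 0 < (#|A|.-1)%:R :> R by rewrite ltr0n -ltnS prednK // (ltn_trans _ A1).
have mS : #|A|%:R = (#|A|.-1)%:R + 1 :> R.
  by rewrite natr1 prednK // ltnW.
pose s := \sum_(i in A) E (A :\ i) g.
have Sdef : S = dot s g.
  by rewrite /s dot_suml; apply: eq_bigr => i _; rewrite dot_symavg.
have S0 : 0 <= S by apply: sumr_ge0 => i _; exact: dot_ge0.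
have row i : i \in A ->
    \sum_(j in A :\ i) dot (E (A :\ i) g) (E (A :\ j) g) =
    (#|A|.-1)%:R^-1 * dot (E (A :\ i) g) (E (A :\ i) g).
  move=> iA; set B := A :\ i.
  have cB : #|B| = #|A|.-1 by rewrite [in RHS](cardsD1 i) iA.
  have AB : A = i |: B by rewrite finset.setD1K.
  have iB : i \notin B by rewrite !inE eqxx.
  have BA : B \subset A by rewrite finset.subD1set.
  have sum0 : \sum_(j in B) act (tperm i j) (E B g) = - E B g.
    have EA : E (i |: B) g = 0 by rewrite -AB.
    have := symavgU1 g iB; rewrite EA => /esym/eqP.
    rewrite scaler_eq0 invr_eq0 pnatr_eq0 /= big_setU1 //= tperm1 act1.
    by rewrite addrC addr_eq0 => /eqP.
  have -> : dot (E B g) (E B g) = - \sum_(j in B) dot (act (tperm i j) (E B g)) g.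
    by rewrite -dot_suml sum0 dotNl opprK dot_symavg.
  rewrite mulrN mulr_sumr -sumrN; apply: eq_bigr => j jB.
  have [ji jA] : j != i /\ j \in A by move: jB; rewrite !inE => /andP[].
  pose h := act (tperm i j) g; pose w := E B h.
  have Ew : E (A :\ j) g = act (tperm i j) w.
    have jD : j \notin B :\ j by rewrite !inE eqxx.
    have iD : i \notin B :\ j by rewrite !inE eqxx andbF.
    rewrite /w /h act_symavg -actM tperm2 act1; congr (E _ g).
    rewrite -[in RHS](finset.setD1K jB) tpermC imset_tpermU1 //.
    apply/setP => x; rewrite !inE; case: eqVneq => [->|_] /=.
      by rewrite (negPf ji).
    by case: eqVneq => [->|].
  have EAw : E A w = 0.
    by rewrite /w symavg_sup // /h /symavg avg_act_group ?tperm_Sym.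
  have Bw : E B w = w by exact: symavg_id.
  rewrite Ew -[in LHS](symavg_id B g) symavg_sym [in LHS]tpermC symavg_tperm //.
  rewrite -AB EAw scaler0 sub0r cB dotZr dotNr /w.
  by rewrite -symavg_sym symavg_id /h [in RHS]dot_act tpermV mulrN.
have ss : dot s s = #|A|%:R / (#|A|.-1)%:R * S.
  rewrite {1}/s dot_suml /S mulr_sumr; apply: eq_bigr => i iA.
  rewrite dot_sumr (big_setD1 i) //= row // mS mulrDl mul1r divff ?mulrDl ?mul1r
    //.
  by rewrite gt_eqF.
have := sqr_dot_le s g; rewrite -Sdef ss expr2.
have [-> _|Sn0] := eqVneq S 0.
  by rewrite mulr_ge0 ?dot_ge0 // divr_ge0.
have Sp : 0 < S by rewrite lt_def Sn0.
move=> D; rewrite -(ler_pM2l Sp); apply: le_trans D _.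
by rewrite mulrA [S * _]mulrC.
Qed.

(** A function far from invariant under the permutations of [A] is, on average,
    far from invariant under those of a one-point deletion of [A]: this is what
    carries estimates from large sets to small ones. *)
Lemma sum_symavgD1_ge A f : (1 < #|A|)%N ->
  #|A|%:R * (1 - (#|A|.-1)%:R^-1) * (dot f f - dot (E A f) (E A f)) <=
  \sum_(i in A) (dot f f - dot (E (A :\ i) f) (E (A :\ i) f)).
Proof.
move=> A1; set g := f - E A f.
have Ag : E A g = 0 by rewrite /g raddfB /= symavg_id subrr.
have := sum_symavgD1_le A1 Ag; rewrite -/g dot_symavgB => D.
have {}D : \sum_(i in A) (dot (E (A :\ i) f) (E (A :\ i) f) -
    dot (E A f) (E A f)) <=
      #|A|%:R / #|A|.-1%:R * (dot f f - dot (E A f) (E A f)).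
  apply: le_trans D; rewrite le_eqVlt; apply/orP; left; apply/eqP.
  apply: eq_bigr => i iA; have iAA := finset.subD1set A i.
  by rewrite -dot_symavgB_sub // /g raddfB /= symavg_sub.
have -> : \sum_(i in A) (dot f f - dot (E (A :\ i) f) (E (A :\ i) f)) =
  #|A|%:R * (dot f f - dot (E A f) (E A f)) - \sum_(i in A)
   (dot (E (A :\ i) f) (E (A :\ i) f) - dot (E A f) (E A f)).
  rewrite mulr_natl -sumr_const -sumrB; apply: eq_bigr => i _.
  by ring.
apply: le_trans (lerB (lexx _) D); rewrite le_eqVlt; apply/orP; left; apply/eqP.
ring.
Qed.

End SymAverageInequalities.

(** * Functions of high degree *)

Section HighDegree.
Variables (R : realFieldType) (n : nat).
Local Notation V := {ffun 'S_n -> R^o}.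
Local Notation E := symavg.
Implicit Types (f g h u v : V) (s t : 'S_n) (A B C : {set 'I_n}) (i j : 'I_n).

(** Orthogonality to every function of fewer than [K] of the values [p x]:
    these are spanned by the ranges of the averages over sets [C] of more than
    [n - K] points. *)
Definition degree_ge K f := forall C, (n - K < #|C|)%N -> E C f = 0.

Lemma degree_ge_symavg K A f : degree_ge K f -> degree_ge K (E A f).
Proof.
move=> fK C CK; rewrite {2}/symavg avgE linearZ_LR linear_sum /=.
rewrite big1 ?scaler0 // => s _.
have -> : C = s @: (s^-1%g @: C).
  by rewrite -imset_comp -[LHS]imset_id; apply: eq_imset => x; rewrite /= permKV.
by rewrite -act_symavg fK ?linear0 // card_imset //; exact: perm_inj.
Qed.

Lemma sum_offdiag_swap (I : finType) (U : {set I}) (F : I -> I -> R) :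
  \sum_(i in U) \sum_(j in U :\ i) F j i = \sum_(i in U) \sum_(j in U :\ i) F i j.
Proof.
rewrite (exchange_big_dep (mem U)) => [|i j _] /=;
  last by rewrite !inE => /andP[].
apply: eq_bigr => j jU; apply: eq_bigl => i.
by rewrite !inE jU andbT andbC eq_sym.
Qed.

(** If [u] depends on [n - #|A|] values and has degree at least [K], then a
    random one of these values matters to the extent of at least
    [K #|A| / ((n - K) (n - #|A|))] of its squared norm. The proof is by downward
    induction on [#|A|], starting from [#|A| = n - K], where every average over
    some [i |: A] kills [u]. With [F i] the average over [i |: A] and [C] the
    union of two such sets, the numbers [dot (F i u) (F j u)] and
    [dot (E C u) (E C u)] agree up to the factor in [dot_symavg_exchange], so the
    induction hypothesis bounds the norm of the sum of the [F i u]; the claim is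
    Cauchy-Schwarz for this sum and [u]. *)
Lemma degree_ge_sum_symavgU1 K A u : (0 < #|A|)%N -> (#|A| + K <= n)%N ->
  E A u = u -> degree_ge K u ->
  (K * #|A|)%:R / (n - K)%:R * dot u u <=
  \sum_(i in ~: A) (dot u u - dot (E (i |: A) u) (E (i |: A) u)).
Proof.
have [d] := ubnP (n - K - #|A|)%N; elim: d => // d IH in A u *.
move=> Ad A0 AK Au uK; set U := ~: A.
have cU : #|U| = (n - #|A|)%N by rewrite cardsCs finset.setCK card_ord.
have nK0 : 0 < (n - K)%:R :> R.
  by rewrite ltr0n; move: (A0) (AK); clear; lia.
have y0 := dot_ge0 u.
set y := dot u u in y0 *; set q := _ / _.
set S := \sum_(i in U) dot (E (i |: A) u) (E (i |: A) u).
have -> : \sum_(i in U) (y - dot (E (i |: A) u) (E (i |: A) u)) = #|U|%:R * y - S.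
  by rewrite sumrB sumr_const mulr_natl.
have qU : q <= #|U|%:R.
  rewrite /q ler_pdivrMr // -natrM ler_nat cU.
  by move: (AK); clear => ?; nia.
have S0 : 0 <= S by apply: sumr_ge0 => i _; exact: dot_ge0.
have [AeK|AltK] := eqVneq (#|A| + K)%N n.
  have -> : S = 0.
    rewrite /S big1 // => i; rewrite inE => iA.
    rewrite uK ?dot0l // cardsU1 iA add1n.
    by move: AeK AK; clear; lia.
  by rewrite subr0 ler_wpM2r.
pose c : R := (#|A|.+1%:R)^-1.
pose e i j := dot (E (j |: (i |: A)) u) (E (j |: (i |: A)) u).
pose Z := \sum_(i in U) \sum_(j in U :\ i)
  (dot (E (i |: A) u) (E (i |: A) u) - e i j).
pose X := \sum_(i in U) \sum_(j in U :\ i) dot (E (i |: A) u) (E (j |: A) u).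
have c1 : (1 - c) * ((K * #|A|.+1)%:R / (n - K)%:R) = q.
  rewrite /q /c !natrM -(natr1 #|A|).
  have : (#|A|%:R + 1 : R) != 0 by rewrite natr1 pnatr_eq0.
  by move: nK0; clear => /lt0r_neq0 a b; field; rewrite a b.
have ZS : q * S <= (1 - c) * Z.
  rewrite -c1 -mulrA ler_wpM2l //.
    by rewrite subr_ge0 /c invf_le1 ?ltr0n // ler1n.
  rewrite /S mulr_sumr; apply: ler_sum => i; rewrite inE => iA.
  have ciA : #|i |: A| = #|A|.+1 by rewrite cardsU1 iA.
  have UiE : ~: (i |: A) = U :\ i by apply/setP => x; rewrite !inE negb_or.
  have := IH (i |: A) (E (i |: A) u); rewrite ciA UiE symavg_id.
  have h1 : (n - K - #|A|.+1 < d)%N.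
    by move: Ad AK AltK A0; clear => *; lia.
  have h2 : (#|A|.+1 + K <= n)%N.
    by move: AK AltK; clear => *; lia.
  move=> /(_ h1 isT h2 erefl (degree_ge_symavg _ uK)) D.
  apply: le_trans D _; apply: ler_sum => j _.
  by rewrite /e symavg_sup // finset.subsetUr.
have XZ : X <= \sum_(i in U) \sum_(j in U :\ i) e i j + c * Z.
  have D : \sum_(i in U) \sum_(j in U :\ i)
      2 * (dot (E (i |: A) u) (E (j |: A) u) - e i j) <=
    \sum_(i in U) \sum_(j in U :\ i) c *
      ((dot (E (i |: A) u) (E (i |: A) u) - e i j) +
       (dot (E (j |: A) u) (E (j |: A) u) - e j i)).
    apply: ler_sum => i; rewrite inE => iA; apply: ler_sum => j;
      rewrite !inE => /andP[ji jA].
    have := @dot_symavg_exchange _ _ A i j u; rewrite eq_sym ji iA jA.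
    move=> /(_ isT isT isT); rewrite /= -/(e i j) -/c => D.
    have -> : e j i = e i j by rewrite /e finset.setUCA.
    by apply: le_trans D _; rewrite le_eqVlt; apply/orP; left; apply/eqP; ring.
  move: D; under eq_bigr do rewrite -mulr_sumr sumrB.
  rewrite -mulr_sumr sumrB -/X.
  under [X in _ <= X]eq_bigr do rewrite -mulr_sumr big_split /=.
  rewrite -mulr_sumr big_split /= -/Z.
  rewrite (sum_offdiag_swap U (fun i j =>
    dot (E (i |: A) u) (E (i |: A) u) - e i j)) -/Z.
  by lra.
have eZ : \sum_(i in U) \sum_(j in U :\ i) e i j = (#|U|%:R - 1) * S - Z.
  apply/eqP; rewrite eq_sym subr_eq addrC /Z -big_split /= /S mulr_sumr;
    apply/eqP.
  apply: eq_bigr => i iU; rewrite -big_split /=.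
  rewrite (eq_bigr (fun=> dot (E (i |: A) u) (E (i |: A) u))) => [|j _];
    last first.
    by ring.
  rewrite sumr_const -[RHS]mulr_natl; congr (_ * _).
  by rewrite [in LHS](cardsD1 i) iU natrD /=; ring.
pose s := \sum_(i in U) E (i |: A) u.
have su : dot s u = S.
  by rewrite /s dot_suml; apply: eq_bigr => i _; rewrite dot_symavg.
have ss : dot s s = S + X.
  rewrite /s dot_suml -big_split; apply: eq_bigr => i iU /=.
  by rewrite dot_sumr (big_setD1 i).
have D : S * S <= S * ((#|U|%:R - q) * y).
  have := sqr_dot_le s u; rewrite su ss expr2 -/y => D.
  apply: le_trans D _; rewrite mulrA ler_wpM2r //.
  by lra.
have [-> |Sn0] := eqVneq S 0; first by rewrite subr0 ler_wpM2r.
have Sp : 0 < S by rewrite lt_def Sn0.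
by move: D; rewrite ler_pM2l //; lra.
Qed.

End HighDegree.

Section AverageMass.
Variables (R : realFieldType) (n : nat).
Local Notation V := {ffun 'S_n -> R^o}.
Local Notation E := symavg.
Implicit Types (f g h u v : V) (s t : 'S_n) (A B C : {set 'I_n}) (i j : 'I_n).

Lemma sum_setD1_setU1 m (F : {set 'I_n} -> {set 'I_n} -> R) :
  \sum_(A : {set 'I_n} | #|A| == m.+1) \sum_(i in A) F (A :\ i) A =
  \sum_(A : {set 'I_n} | #|A| == m) \sum_(i in ~: A) F A (i |: A).
Proof.
rewrite (exchange_big_dep xpredT) //= [RHS](exchange_big_dep xpredT) //=.
apply: eq_bigr => i _.
rewrite (reindex_onto (fun A => i |: A) (fun A => A :\ i)) => [|A /andP[_ iA]];
  last first.
  exact: finset.setD1K.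
apply: eq_big => [A|A /andP[_ /eqP ->] //].
rewrite !inE eqxx /= andbT; case: (boolP (i \in A)) => iA /=.
  rewrite andbF; apply/negbTE; rewrite negb_and; apply/orP; right.
  by apply: contraTneq iA => <-; rewrite !inE eqxx.
by rewrite cardsU1 iA add1n eqSS setU1K // eqxx !andbT.
Qed.

(** For [f] of norm 1 in the isotypic component of a Young diagram, this is the
    probability that the entries [1, ..., m] of a random standard tableau of that
    shape all lie in the first row. *)
Definition symmass m f : R :=
  'C(n, m)%:R^-1 * \sum_(A : {set 'I_n} | #|A| == m) dot (E A f) (E A f).

Lemma card_msets m : #|[pred A : {set 'I_n} | #|A| == m]| = 'C(n, m).
Proof. by have := card_draws 'I_n m; rewrite card_ord cardsE. Qed.

Lemma sum_symmass m f : (m <= n)%N ->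
  \sum_(A : {set 'I_n} | #|A| == m) dot (E A f) (E A f) =
  'C(n, m)%:R * symmass m f.
Proof. by move=> mn; rewrite mulVKf // pnatr_eq0 -lt0n bin_gt0. Qed.

Lemma sum_symmassB m f : (m <= n)%N ->
  \sum_(A : {set 'I_n} | #|A| == m) (dot f f - dot (E A f) (E A f)) =
  'C(n, m)%:R * (dot f f - symmass m f).
Proof.
by move=> mn; rewrite sumrB sum_symmass // sumr_const card_msets -[dot f f *+
  _]mulr_natl mulrBr.
Qed.

Lemma symmass_ge0 m f : 0 <= symmass m f.
Proof. by rewrite mulr_ge0 ?invr_ge0 // sumr_ge0 // => A _; exact: dot_ge0. Qed.

Lemma symmass_le m f : (m <= n)%N -> symmass m f <= dot f f.
Proof.
move=> mn; rewrite -subr_ge0.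
have b0 : 0 < 'C(n, m)%:R :> R by rewrite ltr0n bin_gt0.
rewrite -(pmulr_rge0 _ b0) -sum_symmassB //; apply: sumr_ge0 => A _.
by rewrite subr_ge0 dot_symavg_le.
Qed.

Lemma symmass_step m f : (0 < m)%N -> (m < n)%N ->
  (m%:R - 1) * (dot f f - symmass m.+1 f) <= m%:R * (dot f f - symmass m f).
Proof.
move=> m0 mn.
have m0' : 0 < m%:R :> R by rewrite ltr0n.
have D : \sum_(A : {set 'I_n} | #|A| == m.+1)
    (m.+1%:R * (1 - m%:R^-1) * (dot f f - dot (E A f) (E A f))) <=
  \sum_(A : {set 'I_n} | #|A| == m.+1)
    \sum_(i in A) (dot f f - dot (E (A :\ i) f) (E (A :\ i) f)).
  apply: ler_sum => A /eqP cA.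
  by have := @sum_symavgD1_ge R n A f; rewrite cA ltnS m0 /=; apply.
move: D; rewrite -mulr_sumr sum_symmassB //.
rewrite (sum_setD1_setU1 m (fun B _ => dot f f - dot (E B f) (E B f))).
under [X in _ <= X]eq_bigr => A /eqP cA.
  rewrite sumr_const cardsCs finset.setCK card_ord cA -[(_ - _) *+ _]mulr_natl;
    over.
rewrite /= -mulr_sumr (sum_symmassB f (ltnW mn)) [X in _ <= X]mulrA -natrM.
rewrite -mul_bin_left natrM => D.
have b0 : 0 < m.+1%:R * 'C(n, m.+1)%:R :> R by rewrite mulr_gt0 ?ltr0n ?bin_gt0.
have {}D : (1 - m%:R^-1) * (dot f f - symmass m.+1 f) <= dot f f - symmass m f.
  by rewrite -(ler_pM2l b0); apply: le_trans D;
    rewrite le_eqVlt mulrACA -!mulrA eqxx.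
rewrite -(ler_pM2l m0') in D; apply: le_trans D.
by rewrite mulrA [m%:R * (1 - _)]mulrBr mulr1 mulfV ?gt_eqF.
Qed.

(** The factors [m / (m - 1)] of [symmass_step] telescope. *)
Lemma symmass_mono (s m : nat) f : (0 < s)%N -> (s <= m)%N -> (m <= n)%N ->
  (s%:R - 1) * (dot f f - symmass m f) <= (m%:R - 1) * (dot f f - symmass s f).
Proof.
move=> s0; elim: m => [|m IH]; first by rewrite leqn0 => /eqP s00;
  rewrite s00 in s0.
rewrite leq_eqVlt ltnS => /orP[/eqP -> //|sm mn].
have m0 : (0 < m)%N := leq_trans s0 sm.
have D0 : 0 <= dot f f - symmass s f.
  by rewrite subr_ge0 symmass_le // (leq_trans sm) // ltnW.
have [m1|m1] := leqP m 1.
  have s1 : s = 1%N by move: s0 sm m1; clear; lia.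
  by rewrite s1 in D0 *; rewrite subrr mul0r mulr_ge0 // subr_ge0 ler1n.
have D1 := symmass_step f m0 mn; have D2 := IH sm (ltnW mn).
have m1' : 0 < m%:R - 1 :> R by rewrite subr_gt0 ltr1n.
have s1' : 0 <= s%:R - 1 :> R by rewrite subr_ge0 ler1n.
rewrite -(ler_pM2l m1') mulrCA.
apply: le_trans (ler_wpM2l s1' D1) _.
rewrite mulrCA; apply: le_trans (ler_wpM2l (ler0n _ m) D2) _.
by rewrite -natr1; lra.
Qed.

Lemma symmass_drop K m f : degree_ge K f -> (0 < m)%N -> (m < n)%N ->
  (K * m)%:R / n%:R ^+ 2 * symmass m f <= symmass m f - symmass m.+1 f.
Proof.
move=> fK m0 mn.
have n0 : 0 < n%:R :> R by rewrite ltr0n (leq_trans m0) // ltnW.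
have b0 : 0 < 'C(n, m)%:R :> R by rewrite ltr0n bin_gt0 ltnW.
have nm0 : 0 < (n - m)%:R :> R by rewrite ltr0n subn_gt0.
have S : \sum_(A : {set 'I_n} | #|A| == m) (K * m)%:R / n%:R *
  dot (E A f) (E A f) <=
  \sum_(A : {set 'I_n} | #|A| == m) \sum_(i in ~: A)
     (dot (E A f) (E A f) - dot (E (i |: A) f) (E (i |: A) f)).
  apply: ler_sum => A /eqP cA; have [AK|AK] := leqP (#|A| + K) n; last first.
    rewrite fK ?dot0l ?mulr0; last by move: AK mn cA m0; clear; lia.
    apply: sumr_ge0 => i; rewrite inE => iA.
    rewrite fK ?dot0l ?subrr // cardsU1 iA.
    by move: AK mn cA m0; clear; lia.
  have := @degree_ge_sum_symavgU1 R n K A (E A f); rewrite cA m0 -cA AK symavg_id.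
  move=> /(_ isT isT erefl (degree_ge_symavg _ fK)) D.
  have {}D : (K * #|A|)%:R / (n - K)%:R * dot (E A f) (E A f) <=
      \sum_(i in ~: A) (dot (E A f) (E A f) - dot (E (i |: A) f) (E (i |: A) f)).
    apply: le_trans D _; apply: ler_sum => i _.
    by rewrite symavg_sup // finset.subsetUr.
  apply: le_trans D; rewrite ler_wpM2r ?dot_ge0 // ler_wpM2l //.
  rewrite lef_pV2 ?ler_nat ?leq_subr // posrE ltr0n.
  by move: AK mn cA m0; clear; lia.
have mn' := ltnW mn.
have binE : m.+1%:R * 'C(n, m.+1)%:R = (n - m)%:R * 'C(n, m)%:R :> R.
  by rewrite -!natrM mul_bin_left.
move: S; rewrite -mulr_sumr (sum_symmass f mn').
under [X in _ <= X]eq_bigr => A /eqP cA.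
  rewrite sumrB sumr_const cardsCs finset.setCK card_ord cA -[dot _ _ *+
    _]mulr_natl; over.
rewrite /= sumrB -mulr_sumr (sum_symmass f mn').
rewrite -(sum_setD1_setU1 m (fun _ A => dot (E A f) (E A f))).
under [X in _ - X]eq_bigr => A /eqP cA.
  rewrite sumr_const cA -[dot _ _ *+ _]mulr_natl; over.
rewrite /= -mulr_sumr (sum_symmass f mn) (mulrA m.+1%:R) binE => D.
have : 'C(n, m)%:R * ((K * m)%:R / n%:R * symmass m f) <=
    'C(n, m)%:R * ((n - m)%:R * (symmass m f - symmass m.+1 f)).
  by apply: le_trans (le_trans D _); rewrite le_eqVlt; apply/orP; left; apply/eqP;
    rewrite ?natrM; ring.
rewrite ler_pM2l // => {}D.
have nD : (K * m)%:R / n%:R * symmass m f <=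
  n%:R * (symmass m f - symmass m.+1 f).
  apply: (le_trans D); rewrite ler_wpM2r ?ler_nat ?leq_subr //.
  rewrite -(pmulr_rge0 _ nm0); apply: (le_trans _ D).
  by rewrite mulr_ge0 ?symmass_ge0 // divr_ge0.
rewrite -(ler_pM2l n0); apply: le_trans nD; rewrite le_eqVlt; apply/orP; left;
  apply/eqP.
by field; rewrite gt_eqF.
Qed.

(** Each of the [m] steps from [m] to [2 * m] costs at least the fraction
    [K m / n ^ 2], by [symmass_drop]. *)
Lemma symmass_half K m f : degree_ge K f -> (0 < m)%N -> (2 * m <= n)%N ->
  (n ^ 2 <= K * m ^ 2)%N -> symmass (2 * m) f <= dot f f / 2.
Proof.
move=> fK m0 mn Kmn.
have n0 : 0 < n%:R :> R by rewrite ltr0n; move: m0 mn; clear; lia.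
pose x : R := (K * m)%:R / n%:R ^+ 2.
have x0 : 0 <= x by rewrite divr_ge0 // exprn_ge0 // ltW.
have D (j : nat) : (j <= m)%N -> symmass (m + j) f * (1 +
  j%:R * x) <= symmass m f.
  elim: j => [|j IH] jm; first by rewrite mul0r addr0 mulr1 addn0.
  have := symmass_drop fK (ltn_addr j m0).
  have -> : (m + j < n)%N by move: jm mn m0; clear; lia.
  move=> /(_ isT); have e0 := symmass_ge0 (m + j) f.
  have xe : x * symmass (m + j) f <=
      (K * (m + j))%:R / n%:R ^+ 2 * symmass (m + j) f.
    rewrite ler_wpM2r // ler_wpM2r ?invr_ge0 ?exprn_ge0 ?(ltW n0) //.
    by rewrite ler_nat leq_mul2l leq_addr orbT.
  move=> /(le_trans xe) {}xe; rewrite addnS.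
  apply: le_trans (IH (ltnW jm)).
  have j0 : 0 <= (j.+1%:R : R) by [].
  have Dx : symmass (m + j).+1 f <= (1 - x) * symmass (m + j) f by lra.
  apply: le_trans (ler_wpM2r _ Dx) _; first by rewrite addr_ge0 ?mulr_ge0.
  rewrite mulrAC [X in _ <= X]mulrC ler_wpM2r // -subr_ge0.
  have -> : 1 + j%:R * x - (1 - x) * (1 + j.+1%:R * x) = j.+1%:R * x ^+ 2.
    by rewrite -natr1; ring.
  by rewrite mulr_ge0 ?sqr_ge0.
have := D m (leqnn _); rewrite addnn -mul2n => {}D.
have mx : 1 <= m%:R * x.
  rewrite /x mulrA -natrM ler_pdivlMr ?exprn_gt0 // mul1r -natrX ler_nat.
  by apply: leq_trans Kmn _; rewrite mulnCA expnS expn1.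
have e0 := symmass_ge0 (2 * m) f.
have := symmass_le f (leq_trans (leq_pmull m (isT : 0 < 2)%N) mn).
have : symmass (2 * m) f * 2 <= symmass (2 * m) f * (1 + m%:R * x).
  by rewrite ler_wpM2l //; lra.
by lra.
Qed.

End AverageMass.

(** * Cyclic permutations *)

Section LongCycles.
Variable n : nat.
Implicit Types (c : 'S_n) (A B : {set 'I_n}) (i j : 'I_n).

(** Asking for [A] among the orbits makes this a condition on the number of
    orbits, see [long_cyclesE], whose change under multiplication by a
    transposition is known. For a singleton [A] only the identity remains. *)
Definition long_cycles A : {set 'S_n} :=
  [set c : 'S_n | perm_on A c & A \in porbits c].

Lemma porbit_fixed c i : c i = i -> porbit c i = [set i].
Proof.
move=> ci; apply/setP => x; rewrite inE; apply/porbitP/eqP => [[k ->]|->].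
  by elim: k => [|k IH]; rewrite ?expg0 ?perm1 // expgSr permM IH.
by exists 0%N; rewrite expg0 perm1.
Qed.

Lemma porbit_sub A c i : perm_on A c -> i \in A -> porbit c i \subset A.
Proof.
move=> cA iA; apply/fintype.subsetP => x /porbitP[k ->].
elim: k => [|k IH]; first by rewrite expg0 perm1.
by rewrite expgSr permM perm_closed.
Qed.

Lemma long_cyclesE A c : A != finset.set0 ->
  (c \in long_cycles A) = perm_on A c && (#|porbits c| == (n - #|A|).+1).
Proof.
move=> /set0Pn[x0 x0A]; rewrite inE; case: (boolP (perm_on A c)) => //= cA.
have fix_out i : i \notin A -> porbit c i = [set i].
  by move=> iA; rewrite porbit_fixed ?(out_perm cA).
have orbE : porbits c = porbit c @: A :|: porbit c @: ~: A.
  rewrite -imsetU finset.setUCr; apply/setP => D.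
  by apply/imsetP/imsetP => -[x _ ->]; exists x.
have disj : [disjoint porbit c @: A & porbit c @: ~: A].
  rewrite finset.disjoints_subset; apply/fintype.subsetP => D /imsetP[x xA ->].
  rewrite inE; apply/imsetP => -[y]; rewrite inE => yA /setP /(_ y).
  rewrite porbit_id => /(fintype.subsetP (porbit_sub cA xA)).
  by rewrite (negPf yA).
have card_out : #|porbit c @: ~: A| = (n - #|A|)%N.
  rewrite card_in_imset => [|x y]; first by have := cardsC A; rewrite card_ord;
    lia.
  by rewrite !inE => xA yA; rewrite !fix_out // => /set1_inj.
have {}card_out : #|porbits c| = (#|porbit c @: A| + (n - #|A|))%N.
  by rewrite orbE cardsU (disjoint_setI0 disj) cards0 subn0 card_out.
rewrite card_out -add1n eqn_add2r; apply/imsetP/cards1P => [[x _ Ax]|[D DE]].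
  have orbA y : y \in A -> porbit c y = A.
    by move=> yA; rewrite [RHS]Ax; apply/eqP; rewrite eq_porbit_mem -Ax.
  exists A; apply/setP => D; rewrite inE.
  by apply/imsetP/eqP => [[y yA ->]|->]; [exact: orbA | exists x0; rewrite ?orbA].
have inD y : y \in A -> porbit c y = D.
  by move=> yA; apply/set1P; rewrite -DE imset_f.
exists x0 => //; apply/eqP; rewrite finset.eqEsubset porbit_sub // andbT.
by apply/fintype.subsetP => y yA; rewrite (inD x0) // -(inD y) ?porbit_id.
Qed.

Lemma perm_on_U1 B i c : c i = i -> perm_on (i |: B) c = perm_on B c.
Proof.
move=> ci; apply/fintype.subsetP/fintype.subsetP => H x xc; have := H x xc.
  by rewrite !inE => /orP[/eqP xi|//]; move: xc; rewrite xi inE ci eqxx.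
by rewrite !inE orbC => ->.
Qed.

(** Removing [i] from a cyclic permutation of [i |: B] leaves a cyclic
    permutation of [B], and the place where [i] was is arbitrary. *)
Lemma sum_long_cyclesU1 (V : nmodType) B i (F : 'S_n -> V) :
  i \notin B -> B != finset.set0 ->
  (\sum_(c in long_cycles (i |: B)) F c =
   \sum_(j in B) \sum_(c in long_cycles B) F (tperm i j * c)%g)%R.
Proof.
move=> iB B0.
have iB0 : i |: B != finset.set0 by apply/set0Pn; exists i; rewrite setU11.
have Bn : (#|B| < n)%N.
  rewrite -[X in (_ < X)%N](card_ord n) -cardsT; apply: proper_card.
  by rewrite properT; apply: contraNneq iB => ->; rewrite inE.
rewrite (partition_big (fun c : 'S_n => c^-1%g i) (mem B)) /=; last first.
  move=> c; rewrite inE => /andP[ciB /imsetP[x _ orb]].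
  have := perm_closed i (perm_onV ciB); rewrite setU11 !inE => /orP[/eqP ci|//].
  have {}ci : c i = i by rewrite -{1}ci permKV.
  have : i \in porbit c x by rewrite -orb setU11.
  rewrite -eq_porbit_mem => /eqP Eix.
  case/set0Pn: B0 => y yB; have : y \in i |: B by rewrite !inE yB orbT.
  rewrite orb -Eix porbit_fixed // inE => /eqP yi.
  by rewrite -yi yB in iB.
apply: eq_bigr => j jB; have ij : i != j by apply: contraNneq iB => ->.
rewrite (reindex_inj (mulgI (tperm i j))) /=; apply: eq_bigl => c.
have -> : ((tperm i j * c)^-1 i == j)%g = (c i == i).
  by rewrite -(inj_eq (@perm_inj _ (tperm i j * c)%g)) permKV permM tpermR eq_sym.
rewrite !long_cyclesE // cardsU1 iB add1n.
have [ci|cni] := eqVneq (c i) i; last first.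
  rewrite andbF; apply/esym/negbTE; rewrite negb_and; apply/orP; left.
  apply: contra cni => /fintype.subsetP cB; apply: contraNT iB => ci.
  by apply: cB; rewrite inE.
rewrite andbT -(perm_on_U1 B ci) -!mem_Sym groupMl ?tperm_Sym ?inE ?eqxx ?jB
  ?orbT //.
congr (_ && _); have := porbits_mul_tperm c i j.
have -> /= : i \notin porbit c j.
  by rewrite porbit_sym porbit_fixed // inE eq_sym.
rewrite ij /=; move: Bn; clear.
move: #|porbits (tperm i j * c)| #|porbits c| #|B| => a b k kn /=.
rewrite -[1.*2]/2%N => cE; apply/eqP/eqP; lia.
Qed.

Lemma long_cycles1 i : long_cycles [set i] = 1%g.
Proof.
apply/setP => c; rewrite !inE; apply/andP/eqP => [[ci _]|->].
  by rewrite (perm_on_id ci) // cards1.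
by rewrite perm_on1; split=> //; apply/imsetP; exists i;
  rewrite // porbit_fixed ?perm1.
Qed.

Lemma card_long_cyclesU1 B i : i \notin B -> B != finset.set0 ->
  #|long_cycles (i |: B)| = (#|B| * #|long_cycles B|)%N.
Proof.
move=> iB B0; have := sum_long_cyclesU1 (fun=> 1%N) iB B0.
rewrite sum1_card => ->; rewrite (eq_bigr (fun=> #|long_cycles B|)) => [|j _].
  by rewrite sum_nat_const.
by rewrite sum1_card.
Qed.

Lemma card_long_cycles A : A != finset.set0 -> #|long_cycles A| = (#|A|.-1)`!.
Proof.
have [k] := ubnP #|A|; elim: k => // k IH in A * => Ak A0.
have [i iA] := set0Pn _ A0; pose B := A :\ i.
have AE : A = i |: B by rewrite finset.setD1K.
have iB : i \notin B by rewrite !inE eqxx.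
have cA : #|A| = #|B|.+1 by rewrite AE cardsU1 iB.
have [B0|B0] := eqVneq B finset.set0.
  by rewrite AE B0 finset.setU0 long_cycles1 !cards1.
rewrite [in LHS]AE card_long_cyclesU1 // IH //; last by rewrite -ltnS -cA.
rewrite cA /=; have : (0 < #|B|)%N by rewrite card_gt0.
by case: #|B|.
Qed.

Lemma odd_long_cycles A c : A != finset.set0 -> c \in long_cycles A ->
  odd_perm c = ~~ odd #|A|.
Proof.
move=> A0; rewrite long_cyclesE // => /andP[_ /eqP cE].
rewrite /odd_perm cE card_ord /= oddB ?max_card //; last first.
  by rewrite -[X in (_ <= X)%N](card_ord n) max_card.
by case: (odd n); case: (odd #|A|).
Qed.

Lemma long_cyclesV A c : (c^-1%g \in long_cycles A) = (c \in long_cycles A).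
Proof.
by rewrite !inE porbitsV; congr (_ && _); apply/idP/idP => /perm_onV;
  rewrite ?invgK.
Qed.

End LongCycles.

(** * Averages over the cyclic permutations of a set *)

Section LongCycleAverage.
Variables (R : realFieldType) (n : nat).
Local Notation V := {ffun 'S_n -> R^o}.
Local Notation E := symavg.
Implicit Types (f g h u v : V) (s t : 'S_n) (A B C : {set 'I_n}) (i j : 'I_n).

(** Twisting by the sign turns the sign component of a group of permutations
    into its trivial component, so that [symavg] handles both. *)
Definition sgnmul f : V := [ffun p => (-1) ^+ odd_perm p * f p].

Fact sgnmul_linear : linear sgnmul.
Proof.
move=> a f g; apply/ffunP => p; rewrite !ffunE mulrDr; congr (_ + _).
by rewrite /GRing.scale /= mulrCA.
Qed.

HB.instance Definition _ :=
  GRing.isLinear.Build R V V *:%R sgnmul sgnmul_linear.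

Lemma sgnmulK f : sgnmul (sgnmul f) = f.
Proof. by apply/ffunP => p; rewrite !ffunE signrMK. Qed.

Lemma dot_sgnmul f g : dot (sgnmul f) g = dot f (sgnmul g).
Proof. by apply: eq_bigr => p _; rewrite !ffunE mulrA [f p * _]mulrC. Qed.

Lemma act_sgnmul s f : act s (sgnmul f) = (-1) ^+ odd_perm s *: sgnmul (act s f).
Proof.
apply/ffunP => p; rewrite !ffunE odd_permM signr_addb -mulrA.
by rewrite /GRing.scale.
Qed.

Lemma avg_sgnmul (G : {set 'S_n}) b f :
  (forall s, s \in G -> odd_perm s = b) ->
  avg G (sgnmul f) = (-1) ^+ b *: sgnmul (avg G f).
Proof.
move=> Gb; rewrite !avgE (linearZ_LR sgnmul) (linear_sum sgnmul) /=.
rewrite [RHS]scalerA [X in _ = X *: _]mulrC -[RHS]scalerA.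
congr (_ *: _); rewrite scaler_sumr; apply: eq_bigr => s Gs.
by rewrite act_sgnmul Gb.
Qed.

Lemma symavg_sgnmul A f : (1 < #|A|)%N -> E A (sgnmul (E A f)) = 0.
Proof.
move=> /card_gt1P[i [j [iA jA ij]]]; set g := sgnmul _.
have ijA := tperm_Sym iA jA.
have Eg : E A g = - E A g.
  have Eact : E A (act (tperm i j) g) = E A g by rewrite /symavg avg_act_group.
  rewrite -[LHS]Eact {1}/g act_sgnmul odd_tperm ij.
  by rewrite (symavg_fixed (symavg_id A f) ijA) scaleN1r raddfN.
apply/eqP; have : 2 *: E A g == 0.
  by rewrite scaler_nat mulr2n {1}Eg addNr.
by rewrite scaler_eq0 pnatr_eq0.
Qed.

Definition cycavg A : V -> V := avg (long_cycles A).
HB.instance Definition _ A := GRing.Linear.on (cycavg A).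
Local Notation Z := cycavg.

Lemma card_long_cycles_gt0 A : A != finset.set0 -> (0 < #|long_cycles A|)%N.
Proof. by move=> A0; rewrite card_long_cycles ?fact_gt0. Qed.

Lemma long_cycles_Sym A : long_cycles A \subset Sym A.
Proof. by apply/fintype.subsetP => c; rewrite !inE => /andP[]. Qed.

Lemma cycavg_sym A f g : dot (Z A f) g = dot f (Z A g).
Proof. by apply: avg_sym => c; rewrite long_cyclesV. Qed.

Lemma cycavg_symavg A f : A != finset.set0 -> Z A (E A f) = E A f.
Proof.
by move=> A0; rewrite /cycavg /symavg avg_sub_group ?card_long_cycles_gt0
  ?long_cycles_Sym.
Qed.

Lemma cycavg_sgnmul A f : A != finset.set0 ->
  Z A (sgnmul f) = (-1) ^+ (~~ odd #|A|) *: sgnmul (Z A f).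
Proof. by move=> A0; apply: avg_sgnmul => c; exact: odd_long_cycles. Qed.

Lemma cycavgU1 B i f : i \notin B -> B != finset.set0 ->
  Z (i |: B) f = #|B|%:R^-1 *: \sum_(j in B) act (tperm i j) (Z B f).
Proof.
move=> iB B0; apply: dot_ext => g.
rewrite cycavg_sym /cycavg avgE card_long_cyclesU1 // natrM invfM.
rewrite sum_long_cyclesU1 // dotZr dotZl dot_sumr dot_suml -mulrA; congr (_ * _).
rewrite mulr_sumr; apply: eq_bigr => j jB.
rewrite dot_act tpermV -/(cycavg B f) cycavg_sym /cycavg avgE dotZr;
  congr (_ * _).
by congr (dot _ _); apply: eq_bigr => c _; rewrite actM.
Qed.

Lemma cycavg_on_symavg B i f : i \notin B -> B != finset.set0 ->
  E (i |: B) f = 0 -> Z (i |: B) (E B f) = - (#|B|%:R^-1 *: E B f).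
Proof.
move=> iB B0 f0; rewrite cycavgU1 // cycavg_symavg // -scalerN; congr (_ *: _).
have := symavgU1 f iB; rewrite f0 => /esym/eqP.
rewrite scaler_eq0 invr_eq0 pnatr_eq0 /= big_setU1 //= tperm1 act1.
by rewrite addrC addr_eq0 => /eqP.
Qed.

(** A cyclic permutation of [i |: B] is a cyclic permutation of [B] composed
    with a transposition, so by induction the average contracts wherever the one
    over [B] does. This leaves the trivial and the sign component for [B], where
    the average is [-1 / #|B|] and, up to sign, [1 / #|B|]. *)
Lemma cycavg_contract A h : A != finset.set0 -> E A h = 0 -> E A (sgnmul h) = 0 ->
  dot (Z A h) (Z A h) <= dot h h / 4.
Proof.
have [k] := ubnP #|A|; elim: k => // k IH in A h * => Ak A0 hE hS.
have [i iA] := set0Pn _ A0; pose B := A :\ i.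
have AE : A = i |: B by rewrite finset.setD1K.
have iB : i \notin B by rewrite !inE eqxx.
have cA : #|A| = #|B|.+1 by rewrite AE cardsU1 iB.
have Bk : (#|B| < k)%N by rewrite -ltnS -cA.
have [B0|B0] := eqVneq B finset.set0.
  have h0 : h = 0 by rewrite -hE symavg_small // cA B0 cards0.
  by rewrite h0 raddf0 dot0l mul0r.
move: hE hS; rewrite AE => hE hS.
pose b : R := #|B|%:R^-1.
pose h1 := E B h; pose h2 := sgnmul (E B (sgnmul h)); pose h' := h - h1 - h2.
have Zh1 : Z (i |: B) h1 = - (b *: h1) by exact: cycavg_on_symavg.
have iB0 : i |: B != finset.set0 by rewrite -AE.
pose sg : R := (-1) ^+ (~~ odd #|i |: B|).
have sg2 : sg * sg = 1 by rewrite -expr2 sqrr_sign.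
have Zh2 : Z (i |: B) h2 = - ((sg * b) *: h2).
  by rewrite /h2 cycavg_sgnmul // cycavg_on_symavg // raddfN /= linearZ_LR
    scalerN scalerA.
have b0 : 0 < #|B|%:R :> R by rewrite ltr0n card_gt0.
have [B1|B2] := leqP #|B| 1.
  have cB : #|B| = 1%N by apply/eqP; rewrite eqn_leq B1 card_gt0.
  have h1E : h1 = h by rewrite /h1 symavg_small.
  have h2E : h2 = h by rewrite /h2 symavg_small ?sgnmulK.
  have h0 : h = 0.
    apply/eqP; have : 2 *: h == 0.
      have sgE : sg = -1 by rewrite /sg -AE cA cB expr1.
      have hN : - h = h.
        have := Zh2; rewrite h2E -[in LHS]h1E Zh1 h1E sgE /b cB invr1.
        by rewrite mulN1r scaleN1r opprK scale1r.
      by rewrite scaler_nat mulr2n -{1}hN addNr.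
    by rewrite scaler_eq0 pnatr_eq0.
  by rewrite h0 raddf0 dot0l mul0r.
have h12 : dot h1 h2 = 0 by rewrite /h1 symavg_sym /h2 symavg_sgnmul // dot0r.
have Eh' : E B h' = 0.
  by rewrite /h' !raddfB /= symavg_id symavg_sgnmul // subrr subr0.
have Sh' : E B (sgnmul h') = 0.
  by rewrite /h' !raddfB /= symavg_sgnmul // sgnmulK symavg_id subr0 subrr.
have h'1 : dot h' h1 = 0 by rewrite /h1 -symavg_sym Eh' dot0l.
have h'2 : dot h' h2 = 0.
  by rewrite /h2 -dot_sgnmul -symavg_sym Sh' dot0l.
have Zh' : dot (Z (i |: B) h') (Z (i |: B) h') <= dot h' h' / 4.
  rewrite cycavgU1 //; apply: dot_mean_le => [j jB|]; last first.
    by rewrite divr_ge0 ?dot_ge0.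
  by rewrite dot_act_act IH.
have hE' : h = h1 + h2 + h' by rewrite /h' -(addrA h) -opprD [RHS]addrC subrK.
have Z1 : dot (Z (i |: B) h') h1 = 0.
  by rewrite cycavg_sym Zh1 dotNr dotZr h'1 mulr0 oppr0.
have Z2 : dot (Z (i |: B) h') h2 = 0.
  by rewrite cycavg_sym Zh2 dotNr dotZr h'2 mulr0 oppr0.
have bb : b * b <= 1 / 4.
  rewrite /b -invfM -natrM div1r lef_pV2 ?posrE ?ltr0n ?muln_gt0 ?card_gt0 ?B0 //.
  by rewrite ler_nat; move: B2; clear; nia.
clearbody h' h2 h1.
have -> : dot h h = dot h1 h1 + dot h2 h2 + dot h' h'.
  rewrite hE' !(dotDl, dotDr) (dotC h2 h1) (dotC h1 h') (dotC h2 h') h12 h'1 h'2.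
  by ring.
have -> : dot (Z (i |: B) h) (Z (i |: B) h) =
    b * b * (dot h1 h1 + dot h2 h2) + dot (Z (i |: B) h') (Z (i |: B) h').
  rewrite hE' !raddfD /= Zh1 Zh2 !(dotDl, dotDr, dotNl, dotNr, dotZl, dotZr).
  rewrite (dotC h2 h1) (dotC h1 (Z _ _)) (dotC h2 (Z _ _)) h12 Z1 Z2.
  have -> : b * b * (dot h1 h1 + dot h2 h2) =
    b * b * dot h1 h1 + (sg * sg) * b * b * dot h2 h2 by rewrite sg2; ring.
  by ring.
have := dot_ge0 h1; have := dot_ge0 h2 => p2 p1.
have : b * b * (dot h1 h1 + dot h2 h2) <= 1 / 4 * (dot h1 h1 + dot h2 h2).
  by rewrite ler_wpM2r // addr_ge0.
by lra.
Qed.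

(** Parity enters only here: on the sign component for [A] the average is
    [-1], rather than [1] as it would be for [#|A|] odd. *)
Lemma cycavg_gap A f : A != finset.set0 -> ~~ odd #|A| ->
  (dot f f - dot (E A f) (E A f)) / 2 <= dot (f - Z A f) f.
Proof.
move=> A0 Aeven.
have A2 : (1 < #|A|)%N.
  by move: Aeven A0; rewrite -card_gt0; case: #|A| => [|[]].
pose f1 := E A f; pose f2 := sgnmul (E A (sgnmul f)); pose h := f - f1 - f2.
have Z1 : Z A f1 = f1 by exact: cycavg_symavg.
have Z2 : Z A f2 = - f2.
  by rewrite /f2 cycavg_sgnmul // cycavg_symavg // Aeven scaleN1r.
have f12 : dot f1 f2 = 0 by rewrite /f1 symavg_sym /f2 symavg_sgnmul // dot0r.
have Eh : E A h = 0.
  by rewrite /h !raddfB /= symavg_id symavg_sgnmul // subrr subr0.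
have Sh : E A (sgnmul h) = 0.
  by rewrite /h !raddfB /= symavg_sgnmul // sgnmulK symavg_id subr0 subrr.
have h1 : dot h f1 = 0 by rewrite /f1 -symavg_sym Eh dot0l.
have h2 : dot h f2 = 0 by rewrite /f2 -dot_sgnmul -symavg_sym Sh dot0l.
have Zh1 : dot (Z A h) f1 = 0 by rewrite cycavg_sym Z1.
have Zh2 : dot (Z A h) f2 = 0 by rewrite cycavg_sym Z2 dotNr h2 oppr0.
have Zh := cycavg_contract A0 Eh Sh.
have hh : dot (Z A h) h <= dot h h / 2.
  have := dot_le_half (2 *: Z A h) h; rewrite !(dotZl, dotZr) => D.
  by lra.
have fE : f = f1 + f2 + h by rewrite /h -(addrA f) -opprD [RHS]addrC subrK.
rewrite -/f1 dotBl; clearbody h f2 f1.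
have -> : dot f f = dot f1 f1 + dot f2 f2 + dot h h.
  rewrite fE !(dotDl, dotDr) (dotC f2 f1) (dotC f1 h) (dotC f2 h) f12 h1 h2.
  by ring.
have -> : dot (Z A f) f = dot f1 f1 - dot f2 f2 + dot (Z A h) h.
  rewrite fE !raddfD /= Z1 Z2 !(dotDl, dotDr,
    dotNl) (dotC f2 f1) (dotC f1 h) (dotC f2 h).
  by rewrite f12 h1 h2 Zh1 Zh2; ring.
have := dot_ge0 f2; lra.
Qed.

Lemma cycavg_gap_le A f : A != finset.set0 ->
  dot (f - Z A f) f <= 2 * (dot f f - dot (E A f) (E A f)).
Proof.
move=> A0; pose g := f - E A f.
have fE : f = E A f + g by rewrite /g [RHS]addrC subrK.
have gE : E A g = 0 by rewrite /g raddfB /= symavg_id subrr.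
have Zf : f - Z A f = g - Z A g.
  by rewrite {1 2}fE raddfD /= cycavg_symavg // opprD addrACA subrr add0r.
have gEf : dot g (E A f) = 0 by rewrite -symavg_sym gE dot0l.
rewrite -dot_symavgB -/g; clearbody g.
have -> : dot (f - Z A f) f = dot g g - dot (Z A g) g.
  rewrite Zf {1}fE dotDr !dotBl gEf cycavg_sym cycavg_symavg // gEf.
  by ring.
have := dot_le_half (- Z A g) g; rewrite !(dotNl, dotNr) opprK.
have := dot_avg_le (long_cycles A) g; rewrite -/(Z A g).
by lra.
Qed.

End LongCycleAverage.

(** * The eigenvalues of the walk generated by cycles *)

Section CycleWalk.
Variables (R : realFieldType) (n s : nat).
Local Notation V := {ffun 'S_n -> R^o}.
Local Notation E := symavg.
Implicit Types (f g h u v : V) (c t : 'S_n) (A B C : {set 'I_n}) (i j x : 'I_n).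

Definition cycles : {set 'S_n} := [set c : 'S_n | is_cycle s c].

Lemma cyclesV c : (c^-1%g \in cycles) = (c \in cycles).
Proof.
rewrite !inE; apply: eq_existsb => x; rewrite porbitV; congr (_ && _).
by apply/idP/idP => /perm_onV; rewrite ?invgK.
Qed.

Lemma cyclesJ c t : ((c ^ t)%g \in cycles) = (c \in cycles).
Proof.
suff cycJ d w : d \in cycles -> (d ^ w)%g \in cycles.
  by apply/idP/idP => [/(cycJ _ t^-1%g)|/cycJ //]; rewrite conjgK.
rewrite !inE => /existsP[x /andP[/eqP ds dx]]; apply/existsP; exists (w x).
have -> : porbit (d ^ w)%g (w x) = w @: porbit d x.
  apply/setP => y; apply/porbitP/imsetP => [[k ->]|[z /porbitP[k ->] ->]].
    exists ((d ^+ k)%g x); first exact: mem_porbit.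
    by rewrite -conjXg permJ.
  by exists k; rewrite -conjXg permJ.
rewrite card_imset ?ds ?eqxx //=; last exact: perm_inj.
apply/fintype.subsetP => y;
  rewrite inE -[y](permKV w) permJ (inj_eq perm_inj) => dy.
by rewrite imset_f //; apply: (fintype.subsetP dx); rewrite inE.
Qed.

Lemma long_cycles_support A c : (1 < #|A|)%N -> c \in long_cycles A ->
  [set x | c x != x] = A.
Proof.
move=> A1; rewrite inE => /andP[cA /imsetP[x _ Ax]].
apply/setP => y; rewrite inE; apply/idP/idP => [cy|yA].
  by apply: (fintype.subsetP cA); rewrite inE.
apply: contraTneq A1 => cy; have : porbit c y == porbit c x.
  by rewrite eq_porbit_mem -Ax.
by rewrite -Ax porbit_fixed // => /eqP <-; rewrite cards1.
Qed.

Lemma sum_cycles (U : nmodType) (F : 'S_n -> U) : (1 < s)%N ->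
  \sum_(c in cycles) F c =
  \sum_(A : {set 'I_n} | #|A| == s) \sum_(c in long_cycles A) F c.
Proof.
move=> s1; rewrite (partition_big (fun c : 'S_n => [set x | c x != x])
  (fun A => #|A| == s)) /=.
  apply: eq_bigr => A /eqP cA; apply: eq_bigl => c.
  apply/andP/idP => [[]|cl].
    rewrite inE => /existsP[x /andP[/eqP cs cx]] /eqP supp.
    have cl : c \in long_cycles (porbit c x) by rewrite inE cx imset_f.
    by rewrite -supp (long_cycles_support _ cl) ?cs.
  rewrite (long_cycles_support _ cl) ?cA // inE; split=> //.
  move: cl; rewrite inE => /andP[cA' /imsetP[x _ Ax]].
  by apply/existsP; exists x; rewrite -Ax cA eqxx.
move=> c; rewrite inE => /existsP[x /andP[/eqP cs cx]].
have cl : c \in long_cycles (porbit c x) by rewrite inE cx imset_f.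
by rewrite (long_cycles_support _ cl) ?cs.
Qed.

Lemma set0_card A m : (0 < m)%N -> #|A| = m -> A != finset.set0.
Proof. by move=> m0 cA; rewrite -card_gt0 cA. Qed.

Lemma card_cycles : (1 < s)%N -> #|cycles| = ('C(n, s) * (s.-1)`!)%N.
Proof.
move=> s1; rewrite -sum1_card (sum_cycles (fun=> 1%N)) //.
rewrite (eq_bigr (fun=> (s.-1)`!)) => [|A /eqP cA].
  by rewrite sum_nat_const card_msets.
by rewrite sum1_card card_long_cycles ?cA // (set0_card (ltnW s1) cA).
Qed.

Lemma avg_cycles f : (1 < s)%N ->
  avg cycles f = 'C(n, s)%:R^-1 *: \sum_(A : {set 'I_n} | #|A| == s) cycavg A f.
Proof.
move=> s1; rewrite avgE sum_cycles // card_cycles // natrM invfM -scalerA.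
congr (_ *: _); rewrite scaler_sumr; apply: eq_bigr => A /eqP cA.
by rewrite /cycavg avgE card_long_cycles ?cA // (set0_card (ltnW s1) cA).
Qed.

Section Bounds.
Hypotheses (s1 : (1 < s)%N) (sn : (s <= n)%N).

Let bin0 : 0 < 'C(n, s)%:R :> R.
Proof. by rewrite ltr0n bin_gt0. Qed.

Lemma dot_avg_cycles f : dot (f - avg cycles f) f =
  'C(n, s)%:R^-1 * \sum_(A : {set 'I_n} | #|A| == s) dot (f - cycavg A f) f.
Proof.
rewrite avg_cycles // dotBl dotZl dot_suml.
under [in RHS]eq_bigr do rewrite dotBl.
rewrite sumrB mulrBr; congr (_ - _); rewrite sumr_const card_msets.
by rewrite -[dot f f *+ _]mulr_natl mulKf ?gt_eqF.
Qed.

Lemma avg_cycles_ge f : ~~ odd s ->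
  (dot f f - symmass s f) / 2 <= dot (f - avg cycles f) f.
Proof.
move=> s2; rewrite dot_avg_cycles -(ler_pM2l bin0) mulVKf ?gt_eqF //.
rewrite mulrA -sum_symmassB // mulr_suml; apply: ler_sum => A /eqP cA.
by apply: cycavg_gap; rewrite ?cA // (set0_card (ltnW s1) cA).
Qed.

Lemma avg_cycles_le f :
  dot (f - avg cycles f) f <= 2 * (dot f f - symmass s f).
Proof.
rewrite dot_avg_cycles -(ler_pM2l bin0) mulVKf ?gt_eqF //.
rewrite mulrCA -sum_symmassB // mulr_sumr; apply: ler_sum => A /eqP cA.
by apply: cycavg_gap_le; rewrite (set0_card (ltnW s1) cA).
Qed.

Variables (phi : V) (r : R).
Hypothesis phiE : avg cycles phi = (1 - r) *: phi.

Lemma eigen_cycles (L : {linear V -> V}) :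
  (forall f, avg cycles (L f) = L (avg cycles f)) ->
  avg cycles (L phi) = (1 - r) *: L phi.
Proof. by move=> ->; rewrite phiE linearZ. Qed.

Lemma dot_eigen : dot (phi - avg cycles phi) phi = r * dot phi phi.
Proof. by rewrite phiE dotBl dotZl; ring. Qed.

(** The average over all permutations kills [phi]; [symmass_mono] carries this
    from sets of [n] points to sets of [s] points. *)
Lemma eigen_gap : ~~ odd s -> phi != 0 -> E [set: 'I_n] phi = 0 ->
  (s%:R - 1) <= 2 * (n%:R - 1) * r.
Proof.
move=> s2 /dot_gt0 p0 pT.
have massn : symmass n phi = 0.
  rewrite /symmass big1 ?mulr0 // => A /eqP cA.
  suff -> : A = [set: 'I_n] by rewrite pT dot0l.
  by apply/eqP; rewrite eqEcard finset.subsetT cardsT card_ord cA /=.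
have D1 := symmass_mono phi (ltnW s1) sn (leqnn n).
rewrite massn subr0 in D1.
have D2 := avg_cycles_ge phi s2; rewrite dot_eigen in D2.
have n1 : 0 <= n%:R - 1 :> R.
  by rewrite subr_ge0 ler1n (leq_trans _ sn) // ltnW.
rewrite -(ler_pM2r p0); apply: le_trans D1 _.
have : (n%:R - 1) * (dot phi phi - symmass s phi) <=
  (n%:R - 1) * (2 * (r * dot phi phi)).
  by rewrite ler_wpM2l //; lra.
by lra.
Qed.

(** By [symmass_half] a set of [2 * m] points already shakes off half of [phi];
    [symmass_mono] turns this into a proportional loss for sets of [s] points. *)
Lemma eigen_high_degree K m : ~~ odd s -> phi != 0 -> degree_ge K phi ->
  (s <= 2 * m)%N -> (2 * m <= n)%N -> (n ^ 2 <= K * m ^ 2)%N ->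
  s%:R - 1 <= 8 * m%:R * r.
Proof.
move=> s2 /dot_gt0 p0 pK sm mn Kmn.
have m0 : (0 < m)%N by move: s1 sm; clear; lia.
have D1 := symmass_half pK m0 mn Kmn.
have D2 := symmass_mono phi (ltnW s1) sm mn.
have D3 := avg_cycles_ge phi s2; rewrite dot_eigen in D3.
have s0 : 0 <= s%:R - 1 :> R by rewrite subr_ge0 ler1n ltnW.
have D4 : (s%:R - 1) * (dot phi phi / 2) <=
  (s%:R - 1) * (dot phi phi - symmass (2 * m) phi).
  by rewrite ler_wpM2l //; lra.
have m1 : 0 <= (2 * m)%:R :> R by [].
have e0 := symmass_le phi sn.
have D5 : (2 * m)%:R * (dot phi phi - symmass s phi) <=
  (2 * m)%:R * (2 * (r * dot phi phi)).
  by rewrite ler_wpM2l //; lra.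
rewrite -(ler_pM2r p0); rewrite natrM in D2 D5; lra.
Qed.

Lemma card_msets_mem x :
  #|[pred A : {set 'I_n} | (#|A| == s) && (x \in A)]| = 'C(n.-1, s.-1).
Proof.
have := card_msets n s; rewrite -(cardID [pred A : {set 'I_n} | x \in A]).
have -> : #|[predD [pred A : {set 'I_n} | #|A| == s] & [pred A : {set 'I_n} | x
  \in A]]| = 'C(n.-1, s).
  rewrite -[n in RHS]card_ord -(cardsC1 x) -cards_draws -cardsE;
    apply: eq_card => A.
  rewrite !inE; congr (_ && _); apply/idP/fintype.subsetP => [xA y yA|].
    by rewrite !inE; apply: contraNneq xA => <-.
  by move=> H; apply/negP => /H; rewrite !inE eqxx.
have -> : #|[predI [pred A : {set 'I_n} | #|A| == s] & [pred A : {set 'I_n} | x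
  \in A]]| =
  #|[pred A : {set 'I_n} | (#|A| == s) && (x \in A)]|.
  by apply: eq_card => A; rewrite !inE.
move: #|_| s1 sn => q; case: n s => [|m] [|k] //= _ _; rewrite binS; lia.
Qed.

(** The image of [phi] depends on the values at the points outside [C] only, and
    a random cycle meets one of these [k] points with probability at most
    [k s / n]; otherwise it leaves the image unchanged. *)
Lemma eigen_low_degree C : E C phi != 0 ->
  r * n%:R <= 2 * #|~: C|%:R * s%:R.
Proof.
move=> /dot_gt0; set u := E C phi => u0.
have uE : avg cycles u = (1 - r) *: u.
  by apply: eigen_cycles => f; rewrite /symavg (avg_comm _ _ cyclesJ).
have D := avg_cycles_le u; rewrite uE dotBl dotZl in D.
have {}D : r * dot u u <= 2 * (dot u u - symmass s u) by lra.
have D2 : 'C(n, s)%:R * (dot u u - symmass s u) <=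
    #|~: C|%:R * 'C(n.-1, s.-1)%:R * dot u u.
  rewrite -sum_symmassB //.
  apply: (@le_trans _ _ (\sum_(A : {set 'I_n} | #|A| == s)
    \sum_(x in ~: C) (x \in A)%:R * dot u u)).
    apply: ler_sum => A _; have [AC|] := boolP (A \subset C).
      rewrite {1}/u symavg_sub // subrr; apply: sumr_ge0 => x _.
      by rewrite mulr_ge0 ?dot_ge0.
    case/subsetPn => x xA xC; rewrite (bigD1 x) ?inE //= xA mul1r.
    have: 0 <= \sum_(i in ~: C | i != x) (i \in A)%:R * dot u u.
      by apply: sumr_ge0 => y _; rewrite mulr_ge0 ?dot_ge0.
    have := dot_ge0 (E A u); lra.
  rewrite exchange_big /= -mulrA mulr_natl -sumr_const; apply: ler_sum => x _.
  rewrite -mulr_suml -(card_msets_mem x) -sum1_card natr_sum big_mkcondr /=.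
  rewrite le_eqVlt; apply/orP; left; apply/eqP; congr (_ * _).
  by apply: eq_bigr => A _; case: (x \in A).
have binE : n%:R * 'C(n.-1, s.-1)%:R = s%:R * 'C(n, s)%:R :> R.
  by rewrite -!natrM; move: s1 sn; case: n s => [|m] [|k] // _ _;
    rewrite mul_bin_diag.
have n0 : 0 < n%:R :> R by rewrite ltr0n (leq_trans _ sn) // ltnW.
rewrite -(ler_pM2r u0) -(ler_pM2r bin0).
have D3 : n%:R * ('C(n, s)%:R * (dot u u - symmass s u)) <=
   n%:R * (#|~: C|%:R * 'C(n.-1, s.-1)%:R * dot u u) by rewrite ler_wpM2l // ltW.
have -> : 2 * #|~: C|%:R * s%:R * dot u u * 'C(n, s)%:R =
  2 * (n%:R * (#|~: C|%:R * 'C(n.-1, s.-1)%:R * dot u u)).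
  transitivity (2 * #|~: C|%:R * (s%:R * 'C(n, s)%:R) * dot u u); first by ring.
  by rewrite -binE; ring.
have : n%:R * 'C(n, s)%:R * (r * dot u u) <=
    n%:R * 'C(n, s)%:R * (2 * (dot u u - symmass s u)).
  by rewrite ler_wpM2l // mulr_ge0 // ltW.
by lra.
Qed.

End Bounds.
End CycleWalk.

(** * Generators as averaging operators *)

Section Generator.
Variables (R : realType) (n : nat).
Local Notation V := {ffun 'S_n -> R^o}.
Local Notation E := symavg.
Implicit Types (f g : V).

Lemma cycle_generatorE (nu : R) s (g : 'S_n -> R) p :
  cycle_generator nu s g p =
  nu * #|cycles n s|%:R * (avg (cycles n s) [ffun x => g x] p - g p).
Proof.
rewrite /cycle_generator -mulrA; congr (_ * _).
have [C0|C0] := eqVneq #|cycles n s| 0%N.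
  rewrite C0 mul0r big_pred0 // => c.
  by move: C0 => /eqP; rewrite cards_eq0 => /eqP /setP /(_ c); rewrite !inE.
rewrite avgE !ffunE sum_ffunE mulrBr /GRing.scale /= mulVKf ?pnatr_eq0 //.
rewrite mulr_natl -sumr_const -sumrB.
by apply: eq_big => [c|c _]; rewrite ?inE // !ffunE.
Qed.

Lemma cycles2E : cycles n 2 =
  (fun ij : 'I_n * 'I_n => tperm ij.1 ij.2) @:
    [set ij : 'I_n * 'I_n | (ij.1 < ij.2)%N].
Proof.
apply/setP => c; rewrite inE;
  apply/existsP/imsetP => [[x /andP[/eqP cx xc]]|[[i j]]]; last first.
  rewrite inE /= => ij ->.
  have ne : i != j by apply: contraTneq ij => ->; rewrite ltnn.
  have orbE : porbit (tperm i j) i = [set i; j].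
    apply/eqP; rewrite finset.eqEsubset; apply/andP; split.
      by apply: porbit_sub; [exact: tperm_on | rewrite !inE eqxx].
    apply/fintype.subsetP => y; rewrite !inE => /orP[] /eqP ->;
      first exact: porbit_id.
    by have := mem_porbit (tperm i j) 1 i; rewrite expg1 tpermL.
  by exists i; rewrite orbE cards2 ne /= tperm_on.
have cl : c \in long_cycles (porbit c x) by rewrite inE xc imset_f.
have supp := long_cycles_support _ cl; rewrite cx in supp;
  have {}supp := supp isT.
have xcx : x != c x.
  by rewrite eq_sym; have := porbit_id c x; rewrite -supp inE.
have orbE : porbit c x = [set x; c x].
  apply/esym/eqP; rewrite eqEcard cx cards2 xcx andbT.
  apply/fintype.subsetP => y; rewrite !inE => /orP[] /eqP ->;
    first exact: porbit_id.
  by rewrite -[c x]/((c ^+ 1)%g x) mem_porbit.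
have ccx : c (c x) = x.
  have : c (c x) \in porbit c x by have := mem_porbit c 2 x;
    rewrite expgS permM expg1.
  rewrite orbE !inE => /orP[/eqP //|/eqP];
    rewrite -[c x in RHS]/(c x) => /perm_inj cxx.
  by rewrite cxx eqxx in xcx.
have cE : c = tperm x (c x).
  apply/permP => y; case: tpermP => [->//|->//|yx ycx].
  by apply: (out_perm xc); rewrite orbE !inE; apply/norP; split; apply/eqP.
have [lt|gt|/val_inj eq] := ltngtP x (c x).
- by exists (x, c x); rewrite ?inE.
- by exists (c x, x); rewrite ?inE //= tpermC.
- by rewrite -eq eqxx in xcx.
Qed.

Lemma interchange_cycle (nu : R) :
  @interchange_generator R nu n = cycle_generator nu 2.
Proof.
apply/funext => f; apply/funext => p; congr (_ * _).
rewrite pair_big_dep /=.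
rewrite [RHS](eq_bigl (fun c => c \in cycles n 2)) => [|c]; last by rewrite inE.
rewrite cycles2E big_imset /=; first by apply: eq_bigl => ij; rewrite inE.
move=> [i j] [k l]; rewrite !inE /= => ij kl /permP eqt.
have := eqt i; rewrite tpermL; case: tpermP => [-> -> //|il jk|_ _ ji].
  by move: ij kl; rewrite il jk => lk /(ltn_trans lk); rewrite ltnn.
by rewrite ji ltnn in ij.
Qed.

End Generator.

Local Open Scope classical_set_scope.
Local Open Scope ring_scope.

(** * Transition probabilities from eigenfunctions *)

Section Heat.
Variables (R : realType) (T : finType) (L : generator R T).
Hypothesis L_sum : forall (I : Type) (r : seq I) (g : I -> T -> R),
  L (fun z => \sum_(i <- r) g i z) = fun x => \sum_(i <- r) L (g i) x.
Hypothesis L_scale : forall a (g : T -> R),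
  L (fun z => a * g z) = fun x => a * L g x.

Lemma iter_L_sum k (I : Type) (r : seq I) (g : I -> T -> R) :
  iter k L (fun z => \sum_(i <- r) g i z) =
  fun x => \sum_(i <- r) iter k L (g i) x.
Proof. by elim: k => //= k ->; rewrite L_sum. Qed.

Lemma iter_L_scale k a (g : T -> R) :
  iter k L (fun z => a * g z) = fun x => a * iter k L g x.
Proof. by elim: k => //= k ->; rewrite L_scale. Qed.

Lemma iter_L_eigen k (g : T -> R) theta : (L g = fun x => - theta * g x) ->
  iter k L g = fun x => (- theta) ^+ k * g x.
Proof.
move=> Lg; elim: k => [|k IH]; first by apply/funext => x; rewrite expr0 mul1r.
by rewrite iterS IH L_scale Lg; apply/funext => x; rewrite exprSr mulrA.
Qed.

Lemma cvg_heat (I : Type) (r : seq I) (g : I -> T -> R) (theta : I -> R) t x :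
  (forall i, L (g i) = fun x => - theta i * g i x) ->
  series (fun k : nat => t ^+ k / (k`!)%:R *
      iter k L (fun z => \sum_(i <- r) g i z) x)
    @ \oo --> \sum_(i <- r) expR (- (t * theta i)) * g i x.
Proof.
move=> Lg.
have -> : series (fun k : nat => t ^+ k / (k`!)%:R *
    iter k L (fun z => \sum_(i <- r) g i z) x) =
  fun N => \sum_(i <- r) series (exp_coeff (- (t * theta i))) N * g i x.
  apply/funext => N; rewrite /series /=.
  under eq_bigr do rewrite iter_L_sum mulr_sumr.
  rewrite exchange_big /=; apply: eq_bigr => i _.
  rewrite mulr_suml; apply: eq_bigr => k _.
  rewrite (iter_L_eigen _ (Lg i)) /exp_coeff /= -mulrN exprMn.
  by rewrite mulrA; congr (_ * _); rewrite mulrAC.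
apply: cvg_big => [|i _]; first exact: add_continuous.
by apply: cvgMl; exact: is_cvg_series_exp_coeff.
Qed.

Hypothesis L_diag : forall f : T -> R,
  exists (I : Type) (r : seq I) (g : I -> T -> R) (theta : I -> R),
    (forall i, L (g i) = fun x => - theta i * g i x) /\
    f = fun z => \sum_(i <- r) g i z.

(** The transition probabilities are defined from the indicators of points, so
    the expansion of those is what makes the series converge. *)
Lemma sum_transition (I : Type) (r : seq I) (g : I -> T -> R) (theta : I -> R)
    t x :
  (forall i, L (g i) = fun x => - theta i * g i x) ->
  \sum_y transition L t x y * (\sum_(i <- r) g i y) =
  \sum_(i <- r) expR (- (t * theta i)) * g i x.
Proof.
move=> Lg; have H := cvg_heat (r := r) (t := t) (x := x) Lg.
apply/esym; apply: (cvg_unique _ H) => //.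
pose f y := \sum_(i <- r) g i y.
have fE : (fun z => \sum_(i <- r) g i z) =
    fun z => \sum_(y <- index_enum T) f y * (z == y)%:R.
  apply/funext => z; rewrite [RHS](bigD1 z) //= eqxx mulr1 -/(f z).
  rewrite [X in _ = _ + X]big1 ?addr0 // => y yz.
  by rewrite eq_sym (negPf yz) mulr0.
rewrite fE.
have -> : series (fun k : nat => t ^+ k / (k`!)%:R *
    iter k L (fun z => \sum_(y <- index_enum T) f y * (z == y)%:R) x) =
  fun N => \sum_(y <- index_enum T) series (fun k : nat => t ^+ k / (k`!)%:R *
    iter k L (fun z => (z == y)%:R) x) N * f y.
  apply/funext => N; rewrite /series /=.
  under eq_bigr do rewrite iter_L_sum mulr_sumr.
  rewrite exchange_big /=; apply: eq_bigr => y _.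
  by rewrite mulr_suml; apply: eq_bigr => k _; rewrite iter_L_scale mulrCA mulrC.
apply: cvg_big => [|y _]; first exact: add_continuous.
apply: cvgMl; rewrite /transition.
have [J [q [h [eta [Lh ->]]]]] := L_diag (fun z => (z == y)%:R).
by have := cvg_heat (r := q) (t := t) (x := x) Lh; move/cvgP.
Qed.

End Heat.

(** * Relaxation times *)

Section Decomposition.
Variables (R : realType) (n s1 s2 : nat).
Local Notation V := {ffun 'S_n -> R^o}.
Local Notation E := symavg.

Lemma cycles_SymT s : cycles n s \subset Sym [set: 'I_n]%SET.
Proof.
by apply/fintype.subsetP => c _; rewrite mem_Sym; apply/fintype.subsetP => x;
  rewrite inE.
Qed.

Lemma avg_symavg_comm s C (f : V) :
  avg (cycles n s) (E C f) = E C (avg (cycles n s) f).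
Proof. by rewrite /symavg (avg_comm _ _ (@cyclesJ n s)). Qed.

Lemma avg_cycles_symavgT s (f : V) : (0 < #|cycles n s|)%N ->
  avg (cycles n s) (E [set: 'I_n]%SET f) = E [set: 'I_n]%SET f.
Proof. by move=> C0; rewrite /symavg avg_sub_group ?cycles_SymT. Qed.

Lemma walk_spectral (f : V) : exists (l : seq (R * R)) (phi : R * R -> V),
  [/\ uniq l, f - E [set: 'I_n]%SET f = \sum_(p <- l) phi p &
      forall p, [/\ avg (cycles n s1) (phi p) = p.1 *: phi p,
        avg (cycles n s2) (phi p) = p.2 *: phi p &
        E [set: 'I_n]%SET (phi p) = 0]].
Proof.
have [||g|l [phi [ul fE phiE]]] :=
  @joint_spectral R 'S_n (avg (cycles n s1)) (avg (cycles n s2)) _ _ _ f.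
- exact: (avg_sym (@cyclesV n s1)).
- exact: (avg_sym (@cyclesV n s2)).
- exact: (avg_comm _ _ (@cyclesJ n s1)).
exists l, (fun p => phi p - E [set: 'I_n]%SET (phi p)); split=> // [|p].
  by rewrite sumrB {1}fE; congr (_ - _); rewrite {1}fE raddf_sum.
have [H1 H2] := phiE p.
by split; rewrite raddfB /= ?symavg_id ?subrr // scalerBr avg_symavg_comm
  ?H1 ?H2 linearZ_LR.
Qed.

End Decomposition.

Section Relaxation.
Variables (R : realType) (n s : nat) (nu : R).
Hypotheses (s1 : (1 < s)%N) (sn : (s <= n)%N) (s2 : ~~ odd s) (nu0 : 0 < nu).
Local Notation V := {ffun 'S_n -> R^o}.
Local Notation E := symavg.
Local Notation L := (@cycle_generator R nu n s).

Definition cycle_rate : R := nu * #|cycles n s|%:R.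

Lemma card_cycles_gt0 : (0 < #|cycles n s|)%N.
Proof. by rewrite card_cycles // muln_gt0 bin_gt0 sn fact_gt0. Qed.

Lemma cycle_rate_gt0 : 0 < cycle_rate.
Proof. by rewrite mulr_gt0 // ltr0n card_cycles_gt0. Qed.

Lemma cycle_generator_eigen (phi : V) a : avg (cycles n s) phi = a *: phi ->
  L phi = fun x => - (cycle_rate * (1 - a)) * phi x.
Proof.
move=> phiE; apply/funext => x; rewrite cycle_generatorE -/cycle_rate.
have -> : [ffun x => phi x] = phi by apply/ffunP => y; rewrite ffunE.
by rewrite phiE !ffunE /GRing.scale /=; ring.
Qed.

Lemma positive_eigenvalue_ge theta : positive_eigenvalues_opp L theta ->
  (s%:R - 1) * cycle_rate <= 2 * (n%:R - 1) * theta.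
Proof.
move=> [theta0 [g g0 gE]]; have c0 := cycle_rate_gt0.
pose phi : V := [ffun x => g x]; pose r := theta / cycle_rate.
have rc : r * cycle_rate = theta by rewrite /r divfK // gt_eqF.
have phiE : avg (cycles n s) phi = (1 - r) *: phi.
  apply/ffunP => x; rewrite !ffunE /GRing.scale /=.
  have := gE x; rewrite cycle_generatorE -/cycle_rate -/phi -rc => D.
  have {}D : cycle_rate * (avg (cycles n s) phi x) =
    cycle_rate * ((1 - r) * g x) by lra.
  by move/mulfI : D; apply; rewrite gt_eqF.
have phi0 : phi != 0.
  apply: contra_notN g0 => /eqP /ffunP p0; apply/funext => x.
  by have := p0 x; rewrite !ffunE.
have phiT : E [set: 'I_n]%SET phi = 0.
  have := congr1 (E [set: 'I_n]%SET) phiE.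
  rewrite -avg_symavg_comm avg_cycles_symavgT ?card_cycles_gt0 // linearZ_LR /=
    => /eqP.
  rewrite scalerBl scale1r -subr_eq0 opprB addrCA subrr addr0 scaler_eq0.
  by rewrite /r mulf_eq0 invr_eq0 !gt_eqF //= => /eqP.
have := eigen_gap s1 sn phiE s2 phi0 phiT.
by move=> G; rewrite -rc [X in _ <= X]mulrA ler_pM2r.
Qed.

(** The centred indicator of [p x0 = x0] has degree one, so its components relax
    at a rate proportional to [s / n] by [eigen_low_degree]. *)
Lemma positive_eigenvalue_exists :
  exists2 theta, positive_eigenvalues_opp L theta &
  theta * n%:R <= 2 * s%:R * cycle_rate.
Proof.
have n1 : (1 < n)%N := leq_trans s1 sn.
pose x0 : 'I_n := Ordinal (ltnW n1); pose x1 : 'I_n := Ordinal n1.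
pose C : {set 'I_n} := [set~ x0]%SET; pose T : {set 'I_n} := [set: 'I_n]%SET.
pose g : V := [ffun p : 'S_n => (p x0 == x0)%:R].
pose u := g - E T g.
have CT : C \subset T by exact: finset.subsetT.
have EC : E C u = u.
  rewrite /u raddfB /= symavg_sub //; congr (_ - _).
  apply: avg_fixed => [|p]; first exact: Sym_card_gt0.
  rewrite mem_Sym => pC; apply/ffunP => q; rewrite !ffunE permM.
  by rewrite (out_perm pC) // !inE eqxx.
have u0 : u != 0.
  apply/eqP => u0; have gE : g = E T g by apply/eqP; rewrite -subr_eq0 -/u u0.
  have tT : tperm x0 x1 \in Sym T by rewrite tperm_Sym ?inE.
  have /ffunP /(_ 1%g) := act_avg_group g tT.
  rewrite -/(E T g) -gE !ffunE mulg1 tpermL perm1 eqxx.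
  by case: eqP => [/(congr1 val)|_ /eqP] //; rewrite eq_sym oner_eq0.
have [l [phi [ul uE phiE]]] := walk_spectral s s u.
have ET : E T u = 0 by rewrite /u raddfB /= symavg_id subrr.
rewrite -/T ET subr0 in uE.
have [p psi0] : exists p, E C (phi p) != 0.
  apply/not_existsP => H; move/eqP: u0; apply;
    rewrite -EC uE raddf_sum big1 //= => p _.
  by apply/eqP; have := H p; case: eqP.
have [pE _ pT] := phiE p.
pose psi := E C (phi p); pose r := 1 - p.1.
have phir : avg (cycles n s) (phi p) = (1 - r) *: phi p by rewrite pE /r subKr.
have psiE : avg (cycles n s) psi = p.1 *: psi.
  by rewrite /psi avg_symavg_comm pE linearZ_LR.
have phi0 : phi p != 0 by apply: contraNneq psi0 => ->; rewrite raddf0.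
have gap := eigen_gap s1 sn phir s2 phi0 pT.
have low := eigen_low_degree s1 sn phir psi0.
rewrite finset.setCK cards1 mulr1 in low.
have c0 := cycle_rate_gt0.
have n0 : 0 < n%:R - 1 :> R by rewrite subr_gt0 ltr1n.
have r0 : 0 < r.
  have s0 : 0 < s%:R - 1 :> R by rewrite subr_gt0 ltr1n.
  by have := lt_le_trans s0 gap; rewrite pmulr_rgt0 // mulr_gt0.
exists (cycle_rate * r).
  split; first exact: mulr_gt0.
  exists psi => [psiZ|x].
    by case/eqP: psi0; apply/ffunP => x; rewrite -/psi psiZ ffunE.
  by rewrite (cycle_generator_eigen psiE) mulNr opprK.
by rewrite -mulrA mulrC ler_pM2r.
Qed.

Lemma relaxation_bounds (i := inf (positive_eigenvalues_opp L)) :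
  [/\ 0 < i, (s%:R - 1) * cycle_rate <= 2 * (n%:R - 1) * i &
      i * n%:R <= 2 * s%:R * cycle_rate].
Proof.
have n1 : (1 < n)%N := leq_trans s1 sn.
have n0 : 0 < 2 * (n%:R - 1) :> R by rewrite mulr_gt0 // subr_gt0 ltr1n.
have c0 := cycle_rate_gt0.
have lb : lbound (positive_eigenvalues_opp L)
    ((s%:R - 1) * cycle_rate / (2 * (n%:R - 1))).
  by move=> theta /positive_eigenvalue_ge;
    rewrite ler_pdivrMr // [theta * _]mulrC.
have [theta thetaS theta_le] := positive_eigenvalue_exists.
have ge : (s%:R - 1) * cycle_rate / (2 * (n%:R - 1)) <= i.
  by apply: lb_le_inf lb; exists theta.
split.
- by apply: lt_le_trans ge; rewrite divr_gt0 // mulr_gt0 // subr_gt0 ltr1n.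
- by move: ge; rewrite ler_pdivrMr // [i * _]mulrC.
apply: le_trans theta_le; rewrite ler_wpM2r //.
by apply: ge_inf thetaS; exists ((s%:R - 1) * cycle_rate / (2 * (n%:R - 1))).
Qed.

End Relaxation.

(** * Comparison of the rates of two walks *)

Section Ratio.
Variables (R : realType) (n s : nat) (nu : R).
Hypotheses (s1 : (1 < s)%N) (sn : (s <= n)%N) (s2 : ~~ odd s) (nu0 : 0 < nu).
Local Notation V := {ffun 'S_n -> R^o}.
Local Notation E := symavg.
Local Notation L := (@cycle_generator R nu n s).

(** The relaxation rate of an eigenvector on which the average over the cycles
    is [a], in units of the smallest positive one. *)
Definition relative_rate (a : R) : R :=
  cycle_rate n s nu * (1 - a) * relaxation_time L.

Variables (phi : V) (a : R).
Hypotheses (phiE : avg (cycles n s) phi = a *: phi) (phi0 : phi != 0)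
  (phiT : E [set: 'I_n]%SET phi = 0).

Let phiE' : avg (cycles n s) phi = (1 - (1 - a)) *: phi.
Proof. by rewrite subKr. Qed.

Let i := inf (positive_eigenvalues_opp L).

Let rateE : relative_rate a * i = cycle_rate n s nu * (1 - a).
Proof.
have [i0 _ _] := relaxation_bounds s1 sn s2 nu0.
by rewrite /relative_rate /relaxation_time divfK // gt_eqF.
Qed.

Let s_half : s%:R <= 2 * (s%:R - 1) :> R.
Proof. by have : 2%:R <= s%:R :> R by [rewrite ler_nat]; lra. Qed.

Lemma eigen_lt1 : 0 < 1 - a.
Proof.
have gap := eigen_gap s1 sn phiE' s2 phi0 phiT.
have s0 : 0 < s%:R - 1 :> R by rewrite subr_gt0 ltr1n.
have := lt_le_trans s0 gap; rewrite pmulr_rgt0 // mulr_gt0 // subr_gt0 ltr1n.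
exact: leq_trans sn.
Qed.

Lemma relative_rate_gt0 : 0 < relative_rate a.
Proof.
have [i0 _ _] := relaxation_bounds s1 sn s2 nu0.
by rewrite /relative_rate divr_gt0 // mulr_gt0 ?cycle_rate_gt0 ?eigen_lt1.
Qed.

Lemma relative_rate_low C : E C phi != 0 -> relative_rate a <= 8 * #|~: C|%SET%:R.
Proof.
move=> Cphi; have low := eigen_low_degree s1 sn phiE' Cphi.
have [i0 gap _] := relaxation_bounds s1 sn s2 nu0; rewrite -/i in i0 gap.
have c0 := cycle_rate_gt0 s1 sn nu0; set c := cycle_rate n s nu in c0 gap *.
set k : R := #|~: C|%SET%:R in low *.
have k0 : 0 <= k by [].
have r0 := eigen_lt1.
have s0 : 0 < s%:R - 1 :> R by rewrite subr_gt0 ltr1n.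
have n0 : 0 < n%:R :> R by rewrite ltr0n (leq_trans _ sn) // ltnW.
rewrite -(ler_pM2r i0) rateE -/c.
have H1 : n%:R * ((s%:R - 1) * (c * (1 - a))) <=
  n%:R * ((s%:R - 1) * (8 * k * i)).
  have H2 : ((1 - a) * n%:R) * ((s%:R - 1) * c) <=
    (2 * k * s%:R) * (2 * (n%:R - 1) * i).
    by apply: ler_pM => //; apply: mulr_ge0; apply: ltW.
  have H3 : (2 * k * s%:R) * (2 * (n%:R - 1) * i) <=
    (2 * k * (2 * (s%:R - 1))) * (2 * n%:R * i).
    apply: ler_pM.
    - by rewrite !mulr_ge0.
    - by rewrite !mulr_ge0 ?(ltW i0) // subr_ge0 ler1n -(ltr0n R).
    - by rewrite ler_wpM2l // mulr_ge0.
    by rewrite ler_wpM2r ?(ltW i0) //; lra.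
  rewrite (_ : n%:R * _ = ((1 - a) * n%:R) * ((s%:R - 1) * c)); last by ring.
  rewrite (_ : n%:R * _ = (2 * k * (2 * (s%:R - 1))) * (2 * n%:R * i));
    last by ring.
  exact: le_trans H2 H3.
by move: H1; rewrite !ler_pM2l // => H1.
Qed.

Lemma relative_rate_high K m : degree_ge K phi ->
  (s <= 2 * m)%N -> (2 * m <= n)%N -> (n ^ 2 <= K * m ^ 2)%N ->
  n%:R <= 32 * m%:R * relative_rate a.
Proof.
move=> pK sm mn Kmn;
  have high := eigen_high_degree s1 sn phiE' s2 phi0 pK sm mn Kmn.
have [i0 _ up] := relaxation_bounds s1 sn s2 nu0; rewrite -/i in i0 up.
have c0 := cycle_rate_gt0 s1 sn nu0; set c := cycle_rate n s nu in c0 up.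
rewrite -(ler_pM2r i0) -[X in _ <= X]mulrA rateE -/c [n%:R * i]mulrC;
  apply: le_trans up _.
have H1 : c * s%:R <= c * (2 * (s%:R - 1)) by rewrite ler_pM2l.
have H2 : c * (s%:R - 1) <= c * (8 * m%:R * (1 - a)) by rewrite ler_pM2l.
by lra.
Qed.

End Ratio.

(** A small rate for the first walk forces a bounded degree, by
    [relative_rate_high] with [m] a small multiple of [n], where [s n <= 2 * m]
    for large [n]; a bounded degree bounds the rate for the second walk, by
    [relative_rate_low]. *)
Lemma relative_rate_compare (R : realType) (n0 : nat) (s s' : nat -> nat)
    (nu nu' : nat -> R) :
  (forall n, (n0 <= n)%N -> [/\ (1 < s n)%N, (s n <= n)%N,
    ~~ odd (s n) & 0 < nu n]) ->
  (forall n, (n0 <= n)%N -> [/\ (1 < s' n)%N, (s' n <= n)%N,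
    ~~ odd (s' n) & 0 < nu' n]) ->
  (forall Q, exists N, forall n, (N <= n)%N -> (s n * Q <= n)%N) ->
  forall kappa : R, exists kappa' : R, forall n, (n0 <= n)%N ->
    forall (phi : {ffun 'S_n -> R^o}) a a', phi != 0 ->
      symavg [set: 'I_n]%SET phi = 0 ->
      avg (cycles n (s n)) phi = a *: phi ->
      avg (cycles n (s' n)) phi = a' *: phi ->
      relative_rate n (s n) (nu n) a < kappa ->
      relative_rate n (s' n) (nu' n) a' <= kappa'.
Proof.
move=> hs hs' small kappa.
pose Q := (Num.truncn (32 * `|kappa|)).+2.
have [N sN] := small Q.
pose K := (4 * Q ^ 2)%N.
exists (8 * (K + N + Q)%:R) => n nn phi a a' phi0 phiT phiE phiE' rate.
have [s1 sn s2 nu0] := hs n nn; have [s1' sn' s2' nu0'] := hs' n nn.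
(* The rates are at most [8 * n], so the small [n] only affect [kappa']. *)
have [nN|Nn] := ltnP n (N + Q).
  have phiC : symavg finset.set0 phi != 0 by rewrite symavg_small ?cards0.
  apply: le_trans (relative_rate_low s1' sn' s2' nu0' phiE' phi0 phiT phiC) _.
  rewrite finset.setC0 cardsT card_ord ler_pM2l // ler_nat.
  by move: nN; clear; lia.
have [degK|] := pselect (degree_ge K phi).
  (* Degree at least [K] forces a rate of at least [n / (32 m)], hence of at
     least [Q / 32], which exceeds [kappa]. *)
  exfalso; pose m := (n %/ Q)%N.
  have Q0 : (0 < Q)%N by [].
  have m0 : (0 < m)%N.
    by rewrite divn_gt0 //; move: Nn; clear; lia.
  have mQ : (m * Q <= n)%N by exact: leq_trunc_div.
  have nQ : (n < (m.+1) * Q)%N by rewrite ltn_ceil.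
  have sm : (s n <= 2 * m)%N.
    have : (s n <= m)%N by rewrite leq_divRL // sN //; move: Nn; clear; lia.
    by clear; lia.
  have mn : (2 * m <= n)%N.
    by apply: leq_trans mQ; rewrite mulnC leq_mul2l; apply/orP; right.
  have Kmn : (n ^ 2 <= K * m ^ 2)%N.
    rewrite /K (_ : 4 * Q ^ 2 * m ^ 2 = (2 * Q * m) ^ 2)%N;
      last by rewrite !expnMn.
    by rewrite leq_exp2r //; move: nQ m0; clear; nia.
  have := relative_rate_high s1 sn s2 nu0 phiE phi0 degK sm mn Kmn.
  have m0' : 0 < m%:R :> R by rewrite ltr0n.
  have nm : m%:R * (32 * kappa) < n%:R :> R.
    apply: (@lt_le_trans _ _ (m%:R * Q%:R)); last by rewrite -natrM ler_nat.
    rewrite ltr_pM2l //.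
    have := truncnS_gt (32 * `|kappa|); have := ler_norm kappa.
    by rewrite /Q -(natr1 (Num.truncn _).+1); lra.
  have : 32 * m%:R * relative_rate n (s n) (nu n) a <= m%:R * (32 * kappa).
    by rewrite mulrAC [_ * m%:R]mulrC ler_pM2l // ler_pM2l // ltW.
  by lra.
move=> /existsNP[C /not_implyP[CK /eqP phiC]].
apply: le_trans (relative_rate_low s1' sn' s2' nu0' phiE' phi0 phiT phiC) _.
rewrite ler_pM2l // ler_nat.
by have := cardsC C; rewrite card_ord; move: CK; clear; lia.
Qed.

(** * Laws of a process at two times *)

Section FiniteValued.
Variables (R : realType) (d : measure_display) (Om : measurableType d)
  (P : probability Om R) (S : finType) (Z : Om -> S).
Hypothesis mZ : forall z, measurable [set w | Z w = z].

Lemma expectation_finite (h : S -> R) (p : S -> R) :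
  (forall z, P [set w | Z w = z] = (p z)%:E) ->
  expectation P (fun w => h (Z w)) = (\sum_z h z * p z)%:E.
Proof.
move=> Pp; rewrite unlock.
transitivity (\int[P]_w (\sum_(z <- index_enum S)
    (h z)%:E * (\1_[set w | Z w = z] w)%:E))%E.
  apply: eq_integral => w _;
    rewrite (bigD1_seq (Z w)) ?index_enum_uniq ?mem_index_enum //=.
  rewrite indicE mem_set //= mule1 big1_seq ?adde0 // => z /andP[zZ _].
  by rewrite indicE memNset ?mule0 //= => ZE; rewrite ZE eqxx in zZ.
rewrite integral_sum //; last first.
  by move=> z; apply: integrableZl => //; exact: integrable_indic.
rewrite -sumEFin; apply: eq_bigr => z _.
rewrite integralZl //; last exact: integrable_indic.
rewrite EFinM integral_indic // setIT; congr (_ * _)%E; exact: Pp.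
Qed.

Lemma measurable_finite (B : pred S) : measurable [set w | B (Z w)].
Proof.
have -> : [set w | B (Z w)] = \bigcup_(z in [set z | B z]) [set w | Z w = z].
  by apply/seteqP; split=> [w /= BZ|w [z /= Bz ->] //]; exists (Z w).
by apply: fin_bigcup_measurable => // z _.
Qed.

Lemma prob_finite (B : pred S) (p : S -> R) :
  (forall z, P [set w | Z w = z] = (p z)%:E) ->
  P [set w | B (Z w)] = (\sum_z (B z)%:R * p z)%:E.
Proof.
move=> Pp; rewrite -(expectation_indic P (measurable_finite B)).
rewrite -(expectation_finite (fun z => (B z)%:R) Pp); congr expectation.
apply/funext => w; rewrite indicE; case: (boolP (B (Z w))) => BZ.
  by rewrite mem_set.
by rewrite memNset //=; apply/negP.
Qed.

End FiniteValued.

Section TwoTimes.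
Variables (R : realType) (T : finType) (L : generator R T) (mu : T -> R)
  (X : process R T).
Hypothesis XM : markov_chain L mu X.

Lemma measurable_two_times t (z : T * T) : 0 <= t ->
  measurable [set w | (X 0 w, X t w) = z].
Proof.
move=> t0; case: z => x y.
have -> : [set w | (X 0 w, X t w) = (x, y)] =
    [set w | X 0 w = x] `&` [set w | X t w = y].
  by apply/seteqP; split=> w /= [-> ->].
by apply: measurableI; apply: XM.1.
Qed.

Lemma prob_two_times t (z : T * T) : 0 <= t ->
  process_prob X [set w | (X 0 w, X t w) = z] =
  (mu z.1 * transition L t z.1 z.2)%:E.
Proof.
move=> t0; case: z => x y /=.
pose tt (i : nat) : R := if i is 0%N then 0 else t.
pose zz (i : nat) : T := if i is 0%N then x else y.
have tt_mono i : tt i <= tt i.+1 by case: i => [|i] /=.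
have := XM.2 1%N tt zz erefl tt_mono; rewrite big_ord1 /= subr0 => <-.
congr (process_prob X _); apply/seteqP; split => w /=.
  by case=> Xx Xy [|[|]].
by move=> H; rewrite (H 0%N) // (H 1%N).
Qed.

Lemma expectation_two_times t (h : T -> T -> R) : 0 <= t ->
  expectation (process_prob X) (fun w => h (X 0 w) (X t w)) =
  (\sum_x \sum_y h x y * (mu x * transition L t x y))%:E.
Proof.
move=> t0.
rewrite (@expectation_finite _ _ _ (process_prob X) (T * T)%type
  (fun w => (X 0 w, X t w)) (fun z => measurable_two_times z t0)
  (fun z => h z.1 z.2) _ (fun z => prob_two_times z t0)).
by rewrite pair_bigA.
Qed.

Lemma prob_two_times_pred t (B : T -> T -> bool) : 0 <= t ->
  process_prob X [set w | B (X 0 w) (X t w)] =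
  (\sum_x \sum_y (B x y)%:R * (mu x * transition L t x y))%:E.
Proof.
move=> t0.
rewrite (@prob_finite _ _ _ (process_prob X) (T * T)%type
  (fun w => (X 0 w, X t w)) (fun z => measurable_two_times z t0)
  (fun z => B z.1 z.2) _ (fun z => prob_two_times z t0)).
by rewrite pair_bigA.
Qed.

End TwoTimes.

(** * Correlations along a walk *)

Section WalkProcess.
Variables (R : realType) (n s : nat) (nu : R).
Hypotheses (s1 : (1 < s)%N) (sn : (s <= n)%N) (s2 : ~~ odd s) (nu0 : 0 < nu).
Local Notation V := {ffun 'S_n -> R^o}.
Local Notation E := symavg.
Local Notation T := [set: 'I_n]%SET.
Local Notation L := (@cycle_generator R nu n s).
Local Notation N := (#|'S_n|%:R : R).

Lemma cycle_generator_sum (I : Type) (r : seq I) (g : I -> 'S_n -> R) :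
  L (fun z => \sum_(i <- r) g i z) = fun x => \sum_(i <- r) L (g i) x.
Proof.
apply/funext => x; rewrite /cycle_generator -mulr_sumr exchange_big /=.
by congr (_ * _); apply: eq_bigr => c _; rewrite sumrB.
Qed.

Lemma cycle_generator_scale a (g : 'S_n -> R) :
  L (fun z => a * g z) = fun x => a * L g x.
Proof.
apply/funext => x; rewrite /cycle_generator [RHS]mulrCA [in RHS]mulr_sumr.
by congr (_ * _); apply: eq_bigr => c _; rewrite mulrBr.
Qed.

Section Expansion.
Variables (I : eqType) (F : V) (l : seq I) (phi : I -> V) (a : I -> R).

(** [None] stands for the constant part of [F], an eigenfunction of rate 0. *)
Definition mode (o : option I) : 'S_n -> R := 
  if o is Some p then phi p else E T F.

Definition mode_rate (o : option I) : R :=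
  if o is Some p then cycle_rate n s nu * (1 - a p) else 0.

Hypothesis (FE : F - E T F = \sum_(p <- l) phi p).
Hypothesis (phiE : forall p, avg (cycles n s) (phi p) = a p *: phi p).

Lemma mode_eigen o : L (mode o) = fun x => - mode_rate o * mode o x.
Proof.
case: o => [p|] /=; first exact: cycle_generator_eigen.
rewrite (@cycle_generator_eigen _ _ _ nu (E T F) 1).
  by rewrite subrr mulr0.
by rewrite avg_cycles_symavgT ?scale1r // card_cycles_gt0.
Qed.

Lemma sum_mode x : \sum_(o <- None :: map Some l) mode o x = F x.
Proof.
rewrite big_cons big_map /=.
by move/ffunP: FE => /(_ x); rewrite sum_ffunE !ffunE => <-; rewrite addrC subrK.
Qed.

End Expansion.

Lemma cycle_generator_diag (f : 'S_n -> R) :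
  exists (J : Type) (r : seq J) (g : J -> 'S_n -> R) (theta : J -> R),
  (forall i, L (g i) = fun x => - theta i * g i x) /\
  f = fun z => \sum_(i <- r) g i z.
Proof.
have [l [phi [_ FE phiE]]] := walk_spectral s s [ffun x => f x : R^o].
exists (option (R * R)), (None :: map Some l), (mode [ffun x =>
  f x] phi), (mode_rate fst).
split=> [k|]; first by apply: mode_eigen => p; have [] := phiE p.
by apply/funext => x; rewrite (sum_mode FE) ffunE.
Qed.

Section Formula.
Variables (I : eqType) (F : V) (l : seq I) (phi : I -> V) (a : I -> R).
Hypothesis (FE : F - E T F = \sum_(p <- l) phi p).
Hypothesis (phiE : forall p, avg (cycles n s) (phi p) = a p *: phi p).

(** The semigroup at time [t] applied to [F]. *)
Definition heat t : V := E T F +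
  \sum_(p <- l) expR (- (t * (cycle_rate n s nu * (1 - a p)))) *: phi p.

Lemma sum_transition_heat t x : \sum_y transition L t x y * F y = heat t x.
Proof.
have := @sum_transition _ _ L cycle_generator_sum cycle_generator_scale
  cycle_generator_diag _ (None :: map Some l) (mode F phi) (mode_rate a) t x
  (mode_eigen F phiE).
under eq_bigr do rewrite (sum_mode FE).
move=> ->; rewrite big_cons big_map /= mulr0 oppr0 expR0 mul1r.
by rewrite /heat ffunE sum_ffunE; under [in RHS]eq_bigr do rewrite ffunE.
Qed.

Hypothesis (phi_orth : forall p q, p != q -> dot (phi p) (phi q) = 0).
Hypothesis (ul : uniq l) (phiT : forall p, E T (phi p) = 0).

Lemma dot_heat t : dot F (heat t) = dot (E T F) (E T F) +
  \sum_(p <- l) expR (- (t * (cycle_rate n s nu * (1 - a p)))) *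
    dot (phi p) (phi p).
Proof.
have phiTF p : dot (phi p) (E T F) = 0 by rewrite -symavg_sym phiT dot0l.
have Fphi p : p \in l -> dot F (phi p) = dot (phi p) (phi p).
  move=> pl; rewrite -[F](subrK (E T F)) FE dotDl [dot (E T F) _]dotC phiTF.
  rewrite addr0 dot_suml (bigD1_seq p) //= big1_seq ?addr0 // => q /andP[qp _].
  exact: phi_orth.
rewrite /heat dotDr dot_sumr [dot F (E T F)]dotC -dot_symavg; congr (_ + _).
by rewrite !big_seq; apply: eq_bigr => p pl; rewrite dotZr Fphi.
Qed.

Lemma sum_heat t : \sum_x heat t x = \sum_x F x.
Proof.
pose one : V := [ffun=> 1].
have oneE (g : V) : \sum_x g x = dot one g.
  by apply: eq_bigr => x _; rewrite ffunE mul1r.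
have oneT : E T one = one.
  apply: avg_fixed => [|c _]; first exact: Sym_card_gt0.
  by apply/ffunP => x; rewrite !ffunE.
rewrite !oneE /heat dotDr -symavg_sym oneT dot_sumr big1 ?addr0 // => p _.
by rewrite dotZr -oneT symavg_sym phiT dot0r mulr0.
Qed.

End Formula.

Lemma sum_transition1 t x : \sum_y transition L t x y = 1.
Proof.
pose one : V := [ffun=> 1].
have oneT : E T one = one.
  apply: avg_fixed => [|c _]; first exact: Sym_card_gt0.
  by apply/ffunP => y; rewrite !ffunE.
have oneE : one - E T one = \sum_(p <- [::] : seq nat) (fun=> 0 : V) p.
  by rewrite big_nil oneT subrr.
have := @sum_transition_heat _ one [::] (fun=> 0) (fun=> 0) oneE _ t x.
rewrite /heat big_nil addr0 oneT ffunE => <-; last by move=> p;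
  rewrite raddf0 scaler0.
by apply: eq_bigr => y _; rewrite ffunE mulr1.
Qed.

Lemma card_Sn : (0 : R) < N.
Proof. by rewrite ltr0n; apply/card_gt0P; exists 1%g. Qed.

Lemma symavgT (g : V) p : E T g p = N^-1 * \sum_q g q.
Proof.
have ST : Sym T = [set: 'S_n]%SET.
  by apply/setP => c; rewrite !inE; apply/fintype.subsetP => x; rewrite inE.
rewrite /symavg avgE ffunE sum_ffunE ST cardsT; congr (_ * _).
rewrite [RHS](reindex_inj (mulIg p)) /=.
by apply: eq_big => [q|q _]; rewrite ?inE ?ffunE.
Qed.

Section Laws.
Variables (X : process R 'S_n) (f : 'S_n -> bool).
Hypothesis XM : markov_chain L (@uniform_law R 'S_n) X.
Let F : V := [ffun x => (f x)%:R].
Variables (I : eqType) (l : seq I) (phi : I -> V) (a : I -> R).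
Hypothesis (FE : F - E T F = \sum_(p <- l) phi p).
Hypothesis (phiE : forall p, avg (cycles n s) (phi p) = a p *: phi p).
Hypothesis (phi_orth : forall p q, p != q -> dot (phi p) (phi q) = 0).
Hypothesis (ul : uniq l) (phiT : forall p, E T (phi p) = 0).
Local Notation decay t p := (expR (- (t * (cycle_rate n s nu * (1 - a p))))).

Let sumF : \sum_x (f x)%:R = \sum_x F x.
Proof. by apply: eq_bigr => x _; rewrite ffunE. Qed.

Let sum_pF t x : \sum_y transition L t x y * (f y)%:R = heat F l phi a t x.
Proof.
by rewrite -(sum_transition_heat FE phiE); apply: eq_bigr => y _; rewrite ffunE.
Qed.

Let sum_FpF t : \sum_x (f x)%:R * (\sum_y transition L t x y * (f y)%:R) =
  dot (E T F) (E T F) + \sum_(p <- l) decay t p * dot (phi p) (phi p).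
Proof.
rewrite -(dot_heat a FE phi_orth ul phiT) /dot; apply: eq_bigr => x _.
by rewrite sum_pF [F x]ffunE.
Qed.

Let mean := N^-1 * \sum_x F x.

Let dot_mean : dot (E T F) (E T F) = N * mean ^+ 2.
Proof.
rewrite /dot (eq_bigr (fun=> mean ^+ 2)) => [|x _]; last by rewrite symavgT expr2.
by rewrite sumr_const -[LHS]mulr_natl.
Qed.

Lemma expectation_start :
  expectation (process_prob X) (fun w => (f (X 0 w))%:R) = mean%:E.
Proof.
rewrite (expectation_two_times XM (fun x _ => (f x)%:R) (lexx 0)).
congr EFin; rewrite /mean -sumF mulr_sumr; apply: eq_bigr => x _.
by rewrite -!mulr_sumr sum_transition1 mulr1 mulrC.
Qed.

Lemma expectation_end t : 0 <= t ->
  expectation (process_prob X) (fun w => (f (X t w))%:R) = mean%:E.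
Proof.
move=> t0; rewrite (expectation_two_times XM (fun _ y => (f y)%:R) t0).
congr EFin; rewrite /mean -(sum_heat F l a phiT t) mulr_sumr;
  apply: eq_bigr => x _.
by rewrite -sum_pF mulr_sumr; apply: eq_bigr => y _;
  rewrite mulrCA [_%:R * _]mulrC.
Qed.

Lemma covariance_walk t : 0 <= t ->
  covariance (process_prob X)
    (fun w => (f (X 0 w))%:R) (fun w => (f (X t w))%:R) =
  (\sum_(p <- l) decay t p * (dot (phi p) (phi p) / N))%:E.
Proof.
move=> t0; rewrite covariance.unlock expectation_start (expectation_end t0) /=.
transitivity (expectation (process_prob X)
  (fun w => (fun x y => ((f x)%:R - mean) * ((f y)%:R - mean)) (X 0 w) (X t w))).
  by congr expectation.
rewrite (expectation_two_times XM (fun x y =>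
  ((f x)%:R - mean) * ((f y)%:R - mean)) t0).
congr EFin; have N0 := card_Sn.
have inner x : \sum_y ((f x)%:R - mean) * ((f y)%:R - mean) * (N^-1 *
  transition L t x y) =
   N^-1 * ((f x)%:R * heat F l phi a t x - mean * heat F l phi a t x - mean *
     (f x)%:R + mean ^+ 2).
  transitivity (N^-1 * (((f x)%:R - mean) * (heat F l phi a t x - mean *
    \sum_y transition L t x y))).
    rewrite -sum_pF !mulr_sumr -sumrB !mulr_sumr; apply: eq_bigr => y _; ring.
  by rewrite sum_transition1; ring.
rewrite (eq_bigr _ (fun x _ => inner x)) -mulr_sumr big_split /= !sumrB.
have -> : \sum_x (f x)%:R * heat F l phi a t x =
  N * mean ^+ 2 + \sum_(p <- l) decay t p * dot (phi p) (phi p).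
  by rewrite -dot_mean -sum_FpF; apply: eq_bigr => x _; rewrite sum_pF.
rewrite sumr_const -[mean ^+ 2 *+ _]mulr_natl -!mulr_sumr sum_heat // sumF.
have -> : \sum_x F x = N * mean by rewrite /mean mulVKf ?gt_eqF.
under [RHS]eq_bigr do rewrite mulrA mulrC.
rewrite -mulr_sumr; congr (_ * _); ring.
Qed.

Lemma prob_neq_walk t : 0 <= t ->
  process_prob X [set w | f (X 0 w) != f (X t w)] =
  (2 * \sum_(p <- l) (1 - decay t p) * (dot (phi p) (phi p) / N))%:E.
Proof.
move=> t0; rewrite (prob_two_times_pred XM (fun x y => f x != f y) t0).
congr EFin; have N0 := card_Sn.
have inner x : \sum_y (f x != f y)%:R * (N^-1 * transition L t x y) =
   N^-1 * ((f x)%:R + heat F l phi a t x - 2 * ((f x)%:R * heat F l phi a t x)).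
  transitivity (N^-1 * ((f x)%:R * (\sum_y transition L t x y) +
     heat F l phi a t x - 2 * ((f x)%:R * heat F l phi a t x))).
    rewrite -sum_pF !mulr_sumr -big_split -sumrB !mulr_sumr;
      apply: eq_bigr => y _.
    by case: (f x); case: (f y); rewrite /=; ring.
  by rewrite sum_transition1 mulr1.
rewrite (eq_bigr _ (fun x _ =>
  inner x)) -mulr_sumr sumrB big_split /= sum_heat // sumF.
rewrite -mulr_sumr.
have -> : \sum_x (f x)%:R * heat F l phi a t x =
  dot (E T F) (E T F) + \sum_(p <- l) decay t p * dot (phi p) (phi p).
  by rewrite -sum_FpF; apply: eq_bigr => x _; rewrite sum_pF.
have -> : \sum_x F x = dot (E T F) (E T F) + \sum_(p <- l) dot (phi p) (phi p).
  have -> : \sum_x F x = dot F (heat F l phi a 0).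
    have H0 : heat F l phi a 0 = F.
      rewrite /heat; under eq_bigr do rewrite mul0r oppr0 expR0 scale1r.
      by rewrite -FE addrC subrK.
    by rewrite H0; apply: eq_bigr => x _; rewrite ffunE; case: (f x);
      rewrite ?mulr1 ?mulr0.
  rewrite (dot_heat a FE phi_orth ul phiT); congr (_ + _); apply: eq_bigr => p _.
  by rewrite mul0r oppr0 expR0 mul1r.
under [X in _ = 2 * X]eq_bigr do rewrite mulrA mulrBl mul1r mulrC.
by rewrite -mulr_sumr sumrB; ring.
Qed.

Lemma sum_weights : \sum_(p <- l) dot (phi p) (phi p) / N <= 1.
Proof.
rewrite -mulr_suml ler_pdivrMr ?card_Sn // mul1r.
have := dot_heat a FE phi_orth ul phiT 0.
have -> : heat F l phi a 0 = F.
  rewrite /heat; under eq_bigr do rewrite mul0r oppr0 expR0 scale1r.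
  by rewrite -FE addrC subrK.
under [X in _ = _ + X]eq_bigr do rewrite mul0r oppr0 expR0 mul1r.
move=> D; have := dot_ge0 (E T F).
have : dot F F <= N.
  have -> : N = \sum_(x : 'S_n) 1 by rewrite sumr_const.
  rewrite /dot; apply: ler_sum => x _.
  by rewrite ffunE; case: (f x); rewrite ?mulr1 ?mulr0.
by rewrite D; lra.
Qed.

End Laws.
End WalkProcess.

(** * Transfer of noise sensitivity and stability *)

Section NearZero.
Variables (R : realType) (S : Type) (F : set_system S).
Hypothesis FF : ProperFilter F.

Lemma cvge0P (u : S -> \bar R) : (forall x, (0 <= u x)%E) ->
  u @ F --> 0%E <-> forall e : R, 0 < e -> \forall x \near F, (u x <= e%:E)%E.
Proof.
move=> u0; split=> [/fine_cvgP[ufin /cvgr0Pnorm_le ule] e e0|ule].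
  near=> x; have xfin : u x \is a fin_num by near: x.
  rewrite -(fineK xfin) lee_fin; apply: le_trans (ler_norm _) _.
  by near: x; exact: ule.
apply/fine_cvgP; split.
  near=> x; have : (u x <= 1%:E)%E by near: x; exact: ule.
  by move=> x1; rewrite ge0_fin_numE // (le_lt_trans x1) ?ltry.
apply/cvgr0Pnorm_le => e e0; near=> x.
have xe : (u x <= e%:E)%E by near: x; exact: ule.
have xfin : u x \is a fin_num by rewrite ge0_fin_numE // (le_lt_trans xe) ?ltry.
by rewrite /= ger0_norm ?fine_ge0 // -lee_fin fineK.
Unshelve. all: by end_near. Qed.

End NearZero.

Section Transfer.
Variables (R : realType) (n s s' : nat) (nu nu' : R).
Hypotheses (s1 : (1 < s)%N) (sn : (s <= n)%N) (s2 : ~~ odd s) (nu0 : 0 < nu).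
Hypotheses (s1' : (1 < s')%N) (sn' : (s' <= n)%N).
Hypotheses (s2' : ~~ odd s') (nu0' : 0 < nu').
Local Notation L := (@cycle_generator R nu n s).
Local Notation L' := (@cycle_generator R nu' n s').
Variables (X Y : process R 'S_n) (f : 'S_n -> bool).
Hypotheses (XM : markov_chain L (@uniform_law R 'S_n) X)
  (YM : markov_chain L' (@uniform_law R 'S_n) Y).

Definition cov_after (M : generator R 'S_n) (Z : process R 'S_n) (alpha : R) :
  \bar R :=
  covariance (process_prob Z) (fun w => (f (Z 0 w))%:R)
    (fun w => (f (Z (alpha * relaxation_time M) w))%:R).

Definition neq_after (M : generator R 'S_n) (Z : process R 'S_n) (alpha : R) :
  \bar R :=
  process_prob Z [set w | f (Z 0 w) != f (Z (alpha * relaxation_time M) w)].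

(** The two walks are diagonalized together, so one family of masses, carried by
    pairs of rates, describes [f] along both. *)
Lemma spectral_measure : exists (l : seq (R * R)) (w rho rho' : R * R -> R),
  [/\ forall p, 0 <= w p,
      \sum_(p <- l) w p <= 1,
      forall alpha, 0 <= alpha ->
        cov_after L X alpha = (\sum_(p <- l) expR (- (alpha * rho p)) * w p)%:E /\
        cov_after L' Y alpha = (\sum_(p <- l) expR (- (alpha * rho' p)) * w p)%:E,
      forall alpha, 0 <= alpha ->
        neq_after L X alpha =
          (2 * \sum_(p <- l) (1 - expR (- (alpha * rho p))) * w p)%:E /\
        neq_after L' Y alpha =
          (2 * \sum_(p <- l) (1 - expR (- (alpha * rho' p))) * w p)%:E &
      forall p, w p != 0 -> [/\ 0 < rho p, 0 < rho' p &
        exists phi, [/\ phi != 0, symavg [set: 'I_n]%SET phi = 0,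
          exists2 a, avg (cycles n s) phi = a *: phi &
            rho p = relative_rate n s nu a &
          exists2 a', avg (cycles n s') phi = a' *: phi &
            rho' p = relative_rate n s' nu' a']]].
Proof.
have [l [phi [ul FE phiE]]] := walk_spectral s s' [ffun x => (f x)%:R : R^o].
have H1 p : avg (cycles n s) (phi p) = p.1 *: phi p by have [] := phiE p.
have H2 p : avg (cycles n s') (phi p) = p.2 *: phi p by have [] := phiE p.
have H3 p : symavg [set: 'I_n]%SET (phi p) = 0 by have [] := phiE p.
have orth p q : p != q -> dot (phi p) (phi q) = 0.
  move=> pq.
  have e1 : p.1 * dot (phi p) (phi q) = q.1 * dot (phi p) (phi q).
    by rewrite -dotZl -H1 (avg_sym (@cyclesV n s)) H1 dotZr.
  have e2 : p.2 * dot (phi p) (phi q) = q.2 * dot (phi p) (phi q).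
    by rewrite -dotZl -H2 (avg_sym (@cyclesV n s')) H2 dotZr.
  apply/eqP; apply: contraNT pq => d0; apply/eqP.
  by case: p q e1 e2 d0 => [p1 p2] [q1 q2] /= /mulIf-e1 /mulIf-e2 d0;
    rewrite e1 // e2.
have tau0 : 0 <= relaxation_time L.
  by have [i0 _ _] := relaxation_bounds s1 sn s2 nu0; rewrite invr_ge0 ltW.
have tau0' : 0 <= relaxation_time L'.
  by have [i0 _ _] := relaxation_bounds s1' sn' s2' nu0'; rewrite invr_ge0 ltW.
exists l, (fun p => dot (phi p) (phi p) / #|'S_n|%:R),
  (fun p => relative_rate n s nu p.1), (fun p => relative_rate n s' nu' p.2).
have decayE k (mu : R) (b alpha : R) :
    alpha * relaxation_time (@cycle_generator R mu n k) * (cycle_rate n k mu *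
      (1 - b)) =
    alpha * relative_rate n k mu b by rewrite /relative_rate; ring.
split.
- by move=> p; rewrite divr_ge0 ?dot_ge0.
- exact: (sum_weights s nu fst FE orth ul H3).
- move=> alpha a0; split.
    rewrite /cov_after (covariance_walk s1 sn XM FE H1 orth ul H3) ?mulr_ge0 //.
    by congr EFin; apply: eq_bigr => p _; rewrite decayE.
  rewrite /cov_after (covariance_walk s1' sn' YM FE H2 orth ul H3) ?mulr_ge0 //.
  by congr EFin; apply: eq_bigr => p _; rewrite decayE.
- move=> alpha a0; split.
    rewrite /neq_after (prob_neq_walk s1 sn XM FE H1 orth ul H3) ?mulr_ge0 //.
    by congr (EFin (_ * _)); apply: eq_bigr => p _; rewrite decayE.
  rewrite /neq_after (prob_neq_walk s1' sn' YM FE H2 orth ul H3) ?mulr_ge0 //.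
  by congr (EFin (_ * _)); apply: eq_bigr => p _; rewrite decayE.
move=> p wp; have p0 : phi p != 0.
  by apply: contraNneq wp => ->; rewrite dot0l mul0r.
split; [exact: relative_rate_gt0 (H1 p) p0 (H3 p) | exact: relative_rate_gt0 (H2
  p) p0 (H3 p) |].
by exists (phi p); split=> //; [exists p.1 | exists p.2].
Qed.

Variables (kappa kappa' : R).
Hypothesis compare : forall (phi : {ffun 'S_n -> R^o}) a a', phi != 0 ->
  symavg [set: 'I_n]%SET phi = 0 ->
  avg (cycles n s) phi = a *: phi -> avg (cycles n s') phi = a' *: phi ->
  relative_rate n s nu a < kappa -> relative_rate n s' nu' a' <= kappa'.

(** A mode slower than [kappa] for the first walk still has the share
    [expR (- kappa')] of its mass at time 1 of the second; the faster ones have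
    decayed under the first. *)
Lemma cov_after_le alpha : 0 < alpha ->
  (0 <= cov_after L X alpha <= (expR (- (alpha * kappa)))%:E +
     (expR kappa')%:E * cov_after L' Y 1)%E.
Proof.
move=> a0; have [l [w [rho [rho' [w0 w1 cov _ wE]]]]] := spectral_measure.
have [-> _] := cov alpha (ltW a0); have [_ ->] := cov 1 ler01.
apply/andP; split.
  by rewrite lee_fin; apply: sumr_ge0 => p _; rewrite mulr_ge0 ?expR_ge0.
rewrite -EFinM -EFinD lee_fin.
apply: (@le_trans _ _ (\sum_(p <- l) (expR (- (alpha * kappa)) * w p +
    expR kappa' * (expR (- (1 * rho' p)) * w p)))); last first.
  by rewrite big_split /= -!mulr_sumr lerD2r ler_piMr ?expR_ge0.
apply: ler_sum => p _; have [->|wp] := eqVneq (w p) 0;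
  first by rewrite !mulr0 addr0.
have [r0 r0' [phi [p0 pT [a pa ra] [a' pa' ra']]]] := wE p wp.
rewrite mul1r mulrA -expRD -mulrDl ler_wpM2r //.
have [rk|rk] := ltP (rho p) kappa.
  have rk' : rho' p <= kappa'.
    by rewrite ra'; apply: compare p0 pT pa pa' _; rewrite -ra.
  apply: (@le_trans _ _ 1).
    by rewrite -expR0 ler_expR oppr_le0 mulr_ge0 // ltW.
  rewrite -[1]add0r lerD ?expR_ge0 // -expR0 ler_expR subr_ge0 //.
rewrite -[leLHS]addr0 lerD ?expR_ge0 // ler_expR lerN2.
by rewrite ler_wpM2l // ltW.
Qed.

(** Modes faster than [kappa] for the first walk are mostly lost by its time
    [kappa^-1], so [delta] bounds their mass; the others change by at most
    [alpha * kappa'] under the second walk. *)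
Lemma neq_after_le (delta alpha : R) : 0 < kappa -> 0 <= alpha ->
  (0 <= neq_after L' Y alpha)%E /\
  ((neq_after L X kappa^-1 <= delta%:E)%E ->
   (neq_after L' Y alpha <= (2 * alpha * Num.max kappa' 0 + 2 * delta)%:E)%E).
Proof.
move=> k0 a0; split; first exact: measure_ge0.
have [l [w [rho [rho' [w0 w1 _ neq wE]]]]] := spectral_measure.
have ki : 0 <= kappa^-1 by rewrite invr_ge0 ltW.
have [-> _] := neq _ ki; have [_ ->] := neq alpha a0.
rewrite !lee_fin => D.
have S : \sum_(p <- l) (1 - expR (- (alpha * rho' p))) * w p <=
    \sum_(p <- l) (alpha * Num.max kappa' 0 * w p +
      2 * ((1 - expR (- (kappa^-1 * rho p))) * w p)).
  apply: ler_sum => p _; have [->|wp] := eqVneq (w p) 0;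
    first by rewrite !mulr0 addr0.
  have [r0 r0' [phi [p0 pT [a pa ra] [a' pa' ra']]]] := wE p wp.
  rewrite mulrA -mulrDl ler_wpM2r //.
  have e1 : 0 <= 1 - expR (- (kappa^-1 * rho p)).
    by rewrite subr_ge0 -expR0 ler_expR oppr_le0 mulr_ge0 // ltW.
  have m0 : 0 <= Num.max kappa' 0 by rewrite le_max lexx orbT.
  have [rk|rk] := ltP (rho p) kappa.
    have rk' : rho' p <= kappa'.
      by rewrite ra'; apply: compare p0 pT pa pa' _; rewrite -ra.
    have := expR_ge1Dx (- (alpha * rho' p)).
    have : alpha * rho' p <= alpha * Num.max kappa' 0.
      by rewrite ler_wpM2l // le_max rk'.
    by lra.
  have e2 : expR (- (kappa^-1 * rho p)) <= 2^-1.
    apply: (@le_trans _ _ (expR (- 1))).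
      by rewrite ler_expR lerN2 -(ler_pM2l k0) mulVKf ?gt_eqF // mulr1.
    rewrite expRN lef_pV2 ?posrE ?expR_gt0 //.
    by have := expR_ge1Dx (1 : R).
  have := expR_ge0 (- (alpha * rho' p)).
  have : 0 <= alpha * Num.max kappa' 0 by rewrite mulr_ge0.
  by lra.
rewrite big_split /= -!mulr_sumr in S.
have m0 : 0 <= alpha * Num.max kappa' 0 by rewrite mulr_ge0 // le_max lexx orbT.
have : alpha * Num.max kappa' 0 * \sum_(p <- l) w p <= alpha * Num.max kappa' 0.
  by rewrite ler_piMr.
by lra.
Qed.

End Transfer.

(** Both implications rest on the same fact, that the modes slow for the first
    walk are slow for the second; the converse implications follow by exchanging
    the walks. *)
Lemma noise_transfer (R : realType) (n0 : nat) (s s' : nat -> nat)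
    (nu nu' : nat -> R) (X Y : forall n, process R 'S_n)
    (f : forall n, 'S_n -> bool) :
  (forall n, (n0 <= n)%N -> [/\ (1 < s n)%N, (s n <= n)%N,
    ~~ odd (s n) & 0 < nu n]) ->
  (forall n, (n0 <= n)%N -> [/\ (1 < s' n)%N, (s' n <= n)%N,
    ~~ odd (s' n) & 0 < nu' n]) ->
  (forall Q, exists N, forall n, (N <= n)%N -> (s n * Q <= n)%N) ->
  (forall n, (n0 <= n)%N ->
     markov_chain (@cycle_generator R (nu n) n (s n))
                  (@uniform_law R 'S_n) (X n)) ->
  (forall n, (n0 <= n)%N ->
     markov_chain (@cycle_generator R (nu' n) n (s' n))
                  (@uniform_law R 'S_n) (Y n)) ->
  (noise_sensitive n0 (fun n => @cycle_generator R (nu' n) n (s' n)) Y f ->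
   noise_sensitive n0 (fun n => @cycle_generator R (nu n) n (s n)) X f) /\
  (noise_stable n0 (fun n => @cycle_generator R (nu n) n (s n)) X f ->
   noise_stable n0 (fun n => @cycle_generator R (nu' n) n (s' n)) Y f).
Proof.
move=> hs hs' small XM YM.
have cmp := relative_rate_compare hs hs' small.
pose L n := @cycle_generator R (nu n) n (s n).
pose L' n := @cycle_generator R (nu' n) n (s' n).
pose cX alpha n : \bar R :=
  if (n0 <= n)%N then cov_after (f n) (L n) (X n) alpha else 0%E.
pose cY alpha n : \bar R :=
  if (n0 <= n)%N then cov_after (f n) (L' n) (Y n) alpha else 0%E.
split=> [Ysens alpha a0|Xst].
  have cov_le kappa kappa' n : (n0 <= n)%N ->
      (forall (phi : {ffun 'S_n -> R^o}) a a', phi != 0 ->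
        symavg [set: 'I_n]%SET phi = 0 -> avg (cycles n (s n)) phi = a *: phi ->
        avg (cycles n (s' n)) phi = a' *: phi ->
        relative_rate n (s n) (nu n) a < kappa ->
        relative_rate n (s' n) (nu' n) a' <= kappa') ->
      (0 <= cX alpha n <= (expR (- (alpha * kappa)))%:E +
        (expR kappa')%:E * cY 1%R n)%E.
    move=> nn H; rewrite /cX /cY nn.
    have [h1 h2 h3 h4] := hs n nn; have [h1' h2' h3' h4'] := hs' n nn.
    exact: (cov_after_le h1 h2 h3 h4 h1' h2' h3' h4' (f n) (XM n nn) (YM n nn)
      H a0).
  have cY0 n : (0 <= cY 1%R n)%E.
    rewrite /cY; case: ifP => // nn.
    have [h1 h2 h3 h4] := hs n nn; have [h1' h2' h3' h4'] := hs' n nn.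
    have [l [w [rho [rho' [w0 _ cov _ _]]]]] :=
      spectral_measure h1 h2 h3 h4 h1' h2' h3' h4' (f n) (XM n nn) (YM n nn).
    have [_ ->] := cov 1 ler01.
    by rewrite lee_fin; apply: sumr_ge0 => p _; rewrite mulr_ge0 ?expR_ge0.
  have cX0 n : (0 <= cX alpha n)%E.
    have [nn|nn] := boolP (n0 <= n)%N; last by rewrite /cX (negPf nn).
    have [kappa' H] := cmp 0.
    by have /andP[] := cov_le 0 kappa' n nn (H n nn).
  have cX_to : cX alpha @ \oo --> 0%E.
    apply/cvge0P => // e e0.
    pose kappa := 2 / (e * alpha).
    have [kappa' H] := cmp kappa.
    have ke : expR (- (alpha * kappa)) <= e / 2.
      have -> : alpha * kappa = 2 / e by rewrite /kappa; field; rewrite !gt_eqF.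
      rewrite expRN -[leRHS]invrK lef_pV2 ?posrE ?expR_gt0 ?invr_gt0 ?divr_gt0 //.
      by rewrite invf_div; apply: le_trans (expR_ge1Dx _); rewrite lerDr.
    have small_e : 0 < e / (2 * expR kappa').
      by rewrite divr_gt0 // mulr_gt0 ?expR_gt0.
    have := Ysens 1 ltr01; rewrite -/(cY 1) => /(cvge0P _ cY0) /(_ _ small_e) Hn.
    near=> n.
    have cYn : (cY 1%R n <= (e / (2 * expR kappa'))%:E)%E by near: n; exact: Hn.
    have [nn|nn] := boolP (n0 <= n)%N; last by rewrite /cX (negPf nn) lee_fin ltW.
    have /andP[_ le] := cov_le kappa kappa' n nn (H n nn).
    apply: le_trans le _.
    have -> : e%:E = ((e / 2)%:E +
      (expR kappa')%:E * (e / (2 * expR kappa'))%:E)%E.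
      rewrite -EFinM -EFinD; congr EFin.
      by field; rewrite gt_eqF // expR_gt0.
    by apply: leeD; rewrite ?lee_fin // lee_wpmul2l // lee_fin expR_ge0.
  exact: cX_to.
pose nX alpha := ereal_sup [set neq_after (f n) (L n) (X n) alpha | n in
  [set n | (n0 <= n)%N]].
pose nY alpha := ereal_sup [set neq_after (f n) (L' n) (Y n) alpha | n in
  [set n | (n0 <= n)%N]].
have nX0 alpha : (0 <= nX alpha)%E.
  apply: le_trans (ereal_sup_ubound _); last by exists n0 => /=.
  exact: measure_ge0.
have nY0 alpha : (0 <= nY alpha)%E.
  apply: le_trans (ereal_sup_ubound _); last by exists n0 => /=.
  exact: measure_ge0.
have nX_to : nX alpha @[alpha --> (0 : R)^'+] --> 0%E by exact: Xst.
suff nY_to : nY alpha @[alpha --> (0 : R)^'+] --> 0%E by exact: nY_to.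
apply/cvge0P => // e e0.
have e4 : 0 < e / 4 by rewrite divr_gt0.
have := (cvge0P _ nX0).1 nX_to _ e4 => Hx.
have : \forall alpha \near (0 : R)^'+, 0 < alpha /\ (nX alpha <= (e / 4)%:E)%E.
  near=> alpha; split; first by near: alpha; exact: nbhs_right_gt.
  by near: alpha; exact: Hx.
move=> /filter_ex[alpha1 [a1 nX1]].
have [kappa' H] := cmp alpha1^-1.
pose k := Num.max kappa' 0; have k0 : 0 <= k by rewrite le_max lexx orbT.
near=> alpha.
have a0 : 0 < alpha by near: alpha; exact: nbhs_right_gt.
have ak : alpha <= e / (4 * (k + 1)).
  apply: ltW; near: alpha; apply: nbhs_right_lt.
  by rewrite divr_gt0 // mulr_gt0 // ltr_wpDl.
apply: ub_ereal_sup => _ [n /= nn <-].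
have [h1 h2 h3 h4] := hs n nn; have [h1' h2' h3' h4'] := hs' n nn.
have ki : 0 < alpha1^-1 by rewrite invr_gt0.
have [_ le] := neq_after_le h1 h2 h3 h4 h1' h2' h3' h4' (f n) (XM n nn) (YM n nn)
  (H n nn) (e / 4) ki (ltW a0).
apply: le_trans (le _) _.
  by rewrite invrK; apply: le_trans nX1; apply: ereal_sup_ubound; exists n.
rewrite lee_fin -/k.
have : alpha * (k + 1) <= e / 4.
  rewrite -ler_pdivlMr ?ltr_wpDl //.
  by apply: le_trans ak _; rewrite invfM mulrA.
have : 0 <= alpha by exact: ltW.
lra.
Unshelve. all: by end_near. Qed.

Theorem theorem1p3 (R : realType) (n0 : nat) (hn0 : (4 <= n0)%N)
    (s : nat -> nat)
    (s_even : forall n, (n0 <= n)%N -> ~~ odd (s n))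
    (s_gt2 : forall n, (n0 <= n)%N -> (2 < s n)%N)
    (s_le : forall n, (n0 <= n)%N -> (s n <= n)%N)
    (s_small : (s n)%:R / n%:R @[n --> \oo] --> (0 : R))
    (nu nu'' : nat -> R)
    (nu_gt0 : forall n, (n0 <= n)%N -> 0 < nu n)
    (nu''_gt0 : forall n, (n0 <= n)%N -> 0 < nu'' n)
    (X Y : forall n, process R 'S_n)
    (X_chain : forall n, (n0 <= n)%N ->
       markov_chain (@interchange_generator R (nu n) n)
                    (@uniform_law R 'S_n) (X n))
    (Y_chain : forall n, (n0 <= n)%N ->
       markov_chain (@cycle_generator R (nu'' n) n (s n))
                    (@uniform_law R 'S_n) (Y n))
    (f : forall n, 'S_n -> bool) :
  (noise_sensitive n0 (fun n => @interchange_generator R (nu n) n) X f <->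
   noise_sensitive n0 (fun n => @cycle_generator R (nu'' n) n (s n)) Y f) /\
  (noise_stable n0 (fun n => @interchange_generator R (nu n) n) X f <->
   noise_stable n0 (fun n => @cycle_generator R (nu'' n) n (s n)) Y f).
Proof.
have XE : (fun n => @interchange_generator R (nu n) n) =
    fun n => @cycle_generator R (nu n) n 2.
  by apply: functional_extensionality_dep => n; exact: interchange_cycle.
have X_chain' n : (n0 <= n)%N ->
    markov_chain (@cycle_generator R (nu n) n 2) (@uniform_law R 'S_n) (X n).
  by move=> nn; rewrite -interchange_cycle; exact: X_chain.
rewrite XE.
have h2 n : (n0 <= n)%N -> [/\ (1 < 2)%N, (2 <= n)%N, ~~ odd 2 & 0 < nu n].
  move=> nn; split=> //; last exact: nu_gt0.
  by apply: leq_trans (leq_trans hn0 nn).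
have hs n : (n0 <= n)%N -> [/\ (1 < s n)%N, (s n <= n)%N,
  ~~ odd (s n) & 0 < nu'' n].
  by move=> nn; split;
    [exact/ltnW/s_gt2 | exact: s_le | exact: s_even | exact: nu''_gt0].
have small2 Q : exists N, forall n,
  (N <= n)%N -> (2 * Q <= n)%N by exists (2 * Q)%N.
have smalls Q : exists N, forall n, (N <= n)%N -> (s n * Q <= n)%N.
  have Q0 : 0 < (Q.+1%:R : R)^-1 by rewrite invr_gt0.
  have [N _ HN] := (cvgr0Pnorm_le _).1 s_small _ Q0.
  exists N.+1 => n Nn.
  have := HN n (ltnW Nn); rewrite /= ger0_norm ?divr_ge0 //.
  have n_gt0 : 0 < n%:R :> R by rewrite ltr0n (leq_trans _ Nn).
  rewrite ler_pdivrMr // mulrC ler_pdivlMr // -natrM ler_nat.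
  by apply: leq_trans; rewrite leq_mul2l leqnSn orbT.
have [to_sens from_stab] := noise_transfer f h2 hs small2 X_chain' Y_chain.
have [from_sens to_stab] := noise_transfer f hs h2 smalls Y_chain X_chain'.
by split; split.
Qed.
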